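(* Let $\mathcal{M}$ be a finite von Neumann algebra with faithful normal tracial state $\tau$, and let $\alpha>0$. Suppose that $X_1,\dots,X_n$ and $Y_1,\dots,Y_m$ are self-adjoint elements of $\mathcal{M}$ such that $Y_1,\dots,Y_m\in W^*(X_1,\dots,X_n)$. Assume moreover that for every $1\leq j\leq m$ the function $\varepsilon\mapsto\varepsilon^{-1}d_2(Y_j;X_1,\dots,X_n)(\varepsilon)$ is bounded around $\varepsilon=0$. If $\{X_1,\dots,X_n\}$ is an $\alpha$-bounded set, then so is $\{X_1,\dots,X_n,Y_1,\dots,Y_m\}$.
   Context: $W^*(\cdot)$ denotes the von Neumann algebra generated by the listed elements, and $\|x\|_2=\tau(x^*x)^{1/2}$. After enlarging $\mathcal{M}$ (e.g. by a free product) if necessary, there are free families of standard semicircular elements that are free from the given elements of $\mathcal{M}$. **Distance function.** Let $S_1,\dots,S_n$ be a free standard semicircular family, free from the $X_i$ (and from $W^*(X_1,\dots,X_n)$). For $\varepsilon>0$, $$d_2(Y_j;X_1,\dots,X_n)(\varepsilon)=\inf\{\|Y_j-T\|_2 : T\in W^*(X_1+\varepsilon S_1,\dots,X_n+\varepsilon S_n)\}.$$ **Microstates free entropy.** For self-adjoint $X_1,\dots,X_n,Y_1,\dots,Y_m$ in a tracial von Neumann algebra $(\mathcal{M},\tau)$, $R,\varepsilon>0$ and $\ell,k\in\mathbb{N}$, let $\Gamma_R(X_1,\dots,X_n,Y_1,\dots,Y_m;\ell,k,\varepsilon)$ be the set of $(n+m)$-tuples of self-adjoint $k\times k$ complex matrices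 of operator norm at most $R$ whose mixed moments of degree at most $\ell$ with respect to $\frac1k\mathrm{Tr}$ differ from the corresponding moments of $(X_1,\dots,X_n,Y_1,\dots,Y_m)$ with respect to $\tau$ by less than $\varepsilon$. Let $\Gamma_R(X_1,\dots,X_n:Y_1,\dots,Y_m;\ell,k,\varepsilon)$ be its projection onto the first $n$ coordinates. The relative microstates free entropy is $$\chi(X_1,\dots,X_n:Y_1,\dots,Y_m)=\sup_{R>0}\inf_{\ell,\varepsilon}\limsup_{k\to\infty}\Big[k^{-2}\log\mathrm{vol}\,\Gamma_R(X_1,\dots,X_n:Y_1,\dots,Y_m;\ell,k,\varepsilon)+\tfrac n2\log k\Big],$$ where $\mathrm{vol}$ is Lebesgue measure for the Euclidean norm $(\sum_i\mathrm{Tr}(A_i^2))^{1/2}$. **$\alpha$-boundedness.** A tuple (set) $Z_1,\dots,Z_p$ of self-adjoint elements is $\alpha$-bounded if, for a free standard semicircular family $S_1,\dots,S_p$ free from the $Z_i$, $$\limsup_{\varepsilon\to0}\big[\chi(Z_1+\varepsilon S_1,\dots,Z_p+\varepsilon S_p:S_1,\dots,S_p)+(p-\alpha)|\log\varepsilon|\big]<\infty .$$ *)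

(* Defs.v *)
From HB Require Import structures.
From mathcomp Require Import all_boot all_order all_algebra.
From mathcomp Require Import sesquilinear complex.
From mathcomp Require Import all_classical all_reals all_analysis.

Set Implicit Arguments.
Unset Strict Implicit.
Unset Printing Implicit Defensive.

Import Order.TTheory GRing.Theory Num.Theory.
Import numFieldNormedType.Exports.

Local Open Scope classical_set_scope.
Local Open Scope ring_scope.
Local Open Scope complex_scope.

Record hilbert (R : realType) := Hilbert {
  hilbert_sort :> completeNormedModType R[i];
  inner : {dot hilbert_sort for (@Num.conj R[i])};
  norm_inner : forall x : hilbert_sort, `|x| ^+ 2 = inner x x }.
Arguments inner {R h}.

Section operators.
Context {R : realType} {H : hilbert R}.

Definition bounded_operator (T : H -> H) : Prop := linear T /\ continuous T.

Definition adjoint_of (T U : H -> H) : Prop :=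
  forall x y : H, inner (T x) y = inner x (U y).

(* [adjoint_of T] has at most one element, and exactly one if [T] is bounded. *)
Definition adj (T : H -> H) : H -> H := xget (fun=> 0) (adjoint_of T).

Definition selfadjoint (T : H -> H) : Prop := adjoint_of T T.

Definition prod_op (J : Type) (w : seq J) (A : J -> H -> H) : H -> H :=
  \big[(fun T U => T \o U)/id]_(i <- w) A i.

Record star_subalgebra (A : set (H -> H)) : Prop := StarSubalgebra {
  star_bounded : A `<=` bounded_operator;
  star_one : A id;
  star_lin : forall (c : R[i]) T U, A T -> A U -> A (c \*: T \+ U);
  star_mul : forall T U, A T -> A U -> A (T \o U);
  star_adj : forall T, A T -> exists2 U, A U & adjoint_of T U }.

Definition commutant (A : set (H -> H)) : set (H -> H) :=
  [set T | bounded_operator T /\ forall U, A U -> T \o U = U \o T].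

Definition von_neumann_algebra (A : set (H -> H)) : Prop :=
  star_subalgebra A /\ commutant (commutant A) = A.

Definition star_alg (A : set (H -> H)) : set (H -> H) :=
  smallest star_subalgebra A.

(* The von Neumann algebra generated by [A]; it is the same whether computed
   in B(H) or in a von Neumann algebra that contains [A]. *)
Definition W_star (A : set (H -> H)) : set (H -> H) :=
  smallest von_neumann_algebra A.

Definition square_summable (xi : nat -> H) : Prop :=
  exists C : R[i], forall N, \sum_(i < N) `|xi i| ^+ 2 <= C.

(* Normality is ultraweak continuity: the ultraweakly continuous functionals
   are the T |-> sum_i <T xi_i, eta_i> with xi and eta square summable. *)
Definition normal_functional (A : set (H -> H)) (tau : (H -> H) -> R[i]) : Prop :=
  exists xi eta : nat -> H,
    [/\ square_summable xi, square_summable eta &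
        forall T, A T -> forall e : R[i], 0 < e -> \forall N \near \oo,
          `|tau T - \sum_(i < N) inner (T (xi i)) (eta i)| < e].

Record faithful_normal_tracial_state
    (A : set (H -> H)) (tau : (H -> H) -> R[i]) : Prop := FaithfulTrace {
  tr_lin : forall (c : R[i]) T U, A T -> A U ->
    tau (c \*: T \+ U) = c * tau T + tau U;
  tr_one : tau id = 1;
  tr_pos : forall T, A T -> 0 <= tau (adj T \o T);
  tr_faithful : forall T, A T -> tau (adj T \o T) = 0 -> T = (fun=> 0);
  tr_tracial : forall T U, A T -> A U -> tau (T \o U) = tau (U \o T);
  tr_normal : normal_functional A tau }.

End operators.

Record tracialVNA (R : realType) := TracialVNA {
  vspace_of : hilbert R;
  vna : set (vspace_of -> vspace_of);
  trace : (vspace_of -> vspace_of) -> R[i];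
  vnaP : von_neumann_algebra vna;
  traceP : faithful_normal_tracial_state vna trace }.
Arguments vna {R}.
Arguments trace {R}.

Definition op (R : realType) (M : tracialVNA R) : Type :=
  vspace_of M -> vspace_of M.

Definition sa_element (R : realType) (M : tracialVNA R) (T : op M) : Prop :=
  vna M T /\ selfadjoint T.

Definition norm2 (R : realType) (M : tracialVNA R) (T : op M) : R :=
  Num.sqrt (complex.Re (trace M (adj T \o T))).

(* Being trace preserving and faithful, [phi] is injective and normal: it
   identifies [M] with a von Neumann subalgebra of [N]. *)
Record enlargement (R : realType) (M N : tracialVNA R) (phi : op M -> op N) :
    Prop := Enlargement {
  enl_in : forall T, vna M T -> vna N (phi T);
  enl_lin : forall (c : R[i]) T U, vna M T -> vna M U ->
    phi (c \*: T \+ U) = c \*: phi T \+ phi U;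
  enl_one : phi id = id;
  enl_mul : forall T U, vna M T -> vna M U -> phi (T \o U) = phi T \o phi U;
  enl_adj : forall T, vna M T -> adjoint_of (phi T) (phi (adj T));
  enl_trace : forall T, vna M T -> trace N (phi T) = trace M T }.

Section free_probability.
Context {R : realType} {M : tracialVNA R}.

(* Freeness of a family of subsets of [M], i.e. of the unital *-algebras
   that they generate. *)
Definition freely_independent (J : Type) (A : J -> set (op M)) : Prop :=
  forall (n : nat) (i : nat -> J) (a : nat -> op M),
    (forall j, (j <= n)%N -> star_alg (A (i j)) (a j) /\ trace M (a j) = 0) ->
    (forall j, (j < n)%N -> i j <> i j.+1) ->
    trace M (prod_op (iota 0 n.+1) a) = 0.

(* Self-adjoint, with distribution (2 pi)^-1 sqrt (4 - t^2) dt on [-2, 2]. *)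
Definition standard_semicircular (S : op M) : Prop :=
  sa_element S /\
  forall p : nat, trace M (iter p (fun T => S \o T) id) =
    (\int[lebesgue_measure]_(t in `[-2, 2])
        (t ^+ p * (Num.sqrt (4 - t ^+ 2) / (2 * pi))))%:C.

Definition free_semicircular_family_free_from
    (J : Type) (S : J -> op M) (A : set (op M)) : Prop :=
  (forall j, standard_semicircular (S j)) /\
  freely_independent (fun o : option J => if o is Some j then [set S j] else A).

Definition perturb (J : Type) (X S : J -> op M) (e : R) : J -> op M :=
  fun j => X j \+ e%:C \*: S j.

Definition d2 (J : Type) (Y : op M) (X S : J -> op M) (e : R) : R :=
  inf [set norm2 (Y \- T) | T in W_star (range (perturb X S e))].

End free_probability.

Section volume.
Context {R : realType}.

(* Lebesgue outer measure on R^J. The sets measured below are projections of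
   sigma-compact sets of microstates, hence measurable. Covers are indexed by
   an arbitrary set [D] to get the counting measure when J is empty. *)
Definition lebesgue_vol (J : finType) (A : set (J -> R)) : \bar R :=
  ereal_inf [set v | exists (D : set nat) (a b : nat -> J -> R),
    [/\ forall l j, a l j <= b l j,
        A `<=` \bigcup_(l in D) [set x | forall j, a l j <= x j <= b l j] &
        v = \esum_(l in D) (\prod_j (b l j - a l j))%:E]].

(* Linear isometry from R^(k x k) onto the self-adjoint matrices with the norm
   Tr(A^2)^(1/2): diagonal entries, and sqrt 2 times the real and imaginary
   parts of the entries above the diagonal, are orthonormal coordinates. *)
Definition herm_mx (k : nat) (x : 'I_k * 'I_k -> R) : 'M[R[i]]_k :=
  \matrix_(a, b)
    if a == b then (x (a, a))%:C
    else if (a < b)%N then (x (a, b) / Num.sqrt 2) +i* (x (b, a) / Num.sqrt 2)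
    else (x (b, a) / Num.sqrt 2) -i* (x (a, b) / Num.sqrt 2).

Definition herm_vol (J : finType) (k : nat) (G : set (J -> 'M[R[i]]_k)) : \bar R :=
  lebesgue_vol [set x : J * ('I_k * 'I_k) -> R |
    G (fun j => herm_mx (fun p => x (j, p)))].

End volume.

Definition tuple_cat (I J T : Type) (X : I -> T) (Y : J -> T) (s : I + J) : T :=
  match s with inl i => X i | inr j => Y j end.

Section entropy.
Context {R : realType} {M : tracialVNA R}.

Definition prod_mx (k : nat) (J : Type) (w : seq J) (A : J -> 'M[R[i]]_k) :
  'M[R[i]]_k := \big[mulmx/1%:M]_(j <- w) A j.

Definition opnorm_le (k : nat) (A : 'M[R[i]]_k) (r : R) : Prop :=
  forall v : 'cV[R[i]]_k,
    \sum_a `|(A *m v) a 0| ^+ 2 <= (r ^+ 2)%:C * \sum_a `|v a 0| ^+ 2.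

Definition microstates (J : finType) (Z : J -> op M) (r : R) (l k : nat) (e : R) :
    set (J -> 'M[R[i]]_k) :=
  [set A | [/\ forall j, map_mx Num.conj (A j)^T = A j,
               forall j, opnorm_le (A j) r &
               forall w : seq J, (size w <= l)%N ->
                 `|k%:R^-1 * \tr (prod_mx w A) - trace M (prod_op w Z)| < e%:C]].
Arguments microstates {J}.

Definition rel_microstates (I J : finType) (X : I -> op M) (Y : J -> op M)
    (r : R) (l k : nat) (e : R) : set (I -> 'M[R[i]]_k) :=
  [set A | exists B : J -> 'M[R[i]]_k,
    microstates (tuple_cat X Y) r l k e (tuple_cat A B)].
Arguments rel_microstates {I J}.

Local Open Scope ereal_scope.

(* [lne 0 = -oo], so [chi] is -oo if microstates are eventually missing. *)
Definition chi (I J : finType) (X : I -> op M) (Y : J -> op M) : \bar R :=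
  ereal_sup [set
    ereal_inf [set
      limn_esup (fun k : nat =>
        (k%:R ^- 2)%:E * lne (herm_vol (rel_microstates X Y r p.1 k p.2))
        + ((#|I|%:R / 2 * ln k%:R)%R)%:E)
    | p in [set p : nat * R | (0 < p.2)%R]]
  | r in [set r : R | (0 < r)%R]].

End entropy.

(* The free semicircular family lives in an enlargement of [M]. Such families
   exist (free products) and the quantities below depend only on the joint
   distribution, hence not on the family, so that it is immaterial that we
   quantify over all of them. *)

Definition d2_linear (R : realType) (M : tracialVNA R) (J : Type)
    (Y : op M) (X : J -> op M) : Prop :=
  forall (N : tracialVNA R) (phi : op M -> op N) (S : J -> op N),
    enlargement phi ->
    free_semicircular_family_free_from S (W_star (range (phi \o X))) ->
    bounded_near (fun e : R => e^-1 * d2 (phi Y) (phi \o X) S e : R^o) 0^'+.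

Definition alpha_bounded (R : realType) (M : tracialVNA R) (alpha : R)
    (J : finType) (Z : J -> op M) : Prop :=
  forall (N : tracialVNA R) (phi : op M -> op N) (S : J -> op N),
    enlargement phi ->
    free_semicircular_family_free_from S (range (phi \o Z)) ->
    (limf_esup (fun e : R => chi (perturb (phi \o Z) S e) S
                            + ((#|J|%:R - alpha) * `|ln e|)%:E) 0^'+ < +oo)%E.

(* Main.v *)
From HB Require Import structures.
Require Import Defs.
From mathcomp Require Import all_boot all_order all_algebra.
From mathcomp Require Import sesquilinear complex.
From mathcomp Require Import all_classical all_reals all_analysis.
From mathcomp Require Import ring lra.

(** Let [e] be the size of the perturbation. By assumption [Y_j] is within [C e] of the von Neumann algebra
    generated by the [X_i + e S_i], and there the polynomials in the generators
    are dense for the 2-norm ([W_star_dense]). Hence [Y_j + e S'_j] is within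
    [K e] of a noncommutative polynomial [P_j] in the [X_i + e S_i], with [K]
    independent of [e] ([d2_approx]).

    The square of a 2-norm distance is a moment. So in every microstate [(A, B)]
    of the tuple of all [X_i + e S_i] and [Y_j + e S'_j], the matrix [B_j] is
    within about [K e sqrt k] of [P_j(A)] in the Hilbert-Schmidt norm. For fixed
    [A] the tuples [B] therefore fill at most a product of [m] balls of radius of
    order [K e sqrt k] in dimension [k * k], of volume at most
    [(c K e / sqrt k) ^ (m * k * k)]; and the centres [P_j(A)] depend continuously
    on [A], so that the volume of the microstates is at most the product of this
    bound and of the volume of the projection ([lebesgue_vol_fibre],
    [vol_rel_microstates]). On the scale of free entropy the [m] new elements
    thus contribute at most [m ln e] and a constant ([chi_fibre]), that is
    [- m |ln e|] up to a constant, which compensates the increase by [m] of the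
    number of elements in the definition of [alpha]-boundedness.

    The distance function refers to semicircular families free from
    [W^*(X_1, ..., X_n)], whereas boundedness refers to families free from the
    [X_i] only: freeness extends from a star algebra to its 2-norm closure
    ([free_closure]). Both this and the approximation by polynomials rest on the
    bicommutant theorem in the form [bicommutant_dense], for square summable
    sequences of vectors, which by normality of the trace gives density for the
    2-norm ([norm2_dense]). It is proved with the orthogonal projection on an
    orbit, obtained with the adjoints of operators from a single representation
    lemma ([riesz]). *)

Set Implicit Arguments.
Unset Strict Implicit.
Unset Printing Implicit Defensive.

Import Order.TTheory GRing.Theory Num.Theory.
Import numFieldNormedType.Exports.

Local Open Scope classical_set_scope.
Local Open Scope ring_scope.
Local Open Scope complex_scope.

(** * Real inner products and the Riesz representation *)

Lemma discriminant_le (R : realType) (a b c : R) :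
  (forall t, 0 <= t ^+ 2 * a + 2 * t * b + c) -> b ^+ 2 <= a * c.
Proof.
move=> q_ge0; have c_ge0 : 0 <= c by have := q_ge0 0; lra.
have [a0|a_neq0] := eqVneq a 0.
  have [-> |b_neq0] := eqVneq b 0; first by rewrite a0; lra.
  have := q_ge0 (- (c + 1) / (2 * b)).
  have -> : (- (c + 1) / (2 * b)) ^+ 2 * a + 2 * (- (c + 1) / (2 * b)) * b + c = - 1.
    by rewrite a0; field.
  lra.
have a_gt0 : 0 < a.
  rewrite lt_neqAle eq_sym a_neq0 leNgt; apply/negP => a_lt0.
  set s := (c + 1 + `|b|) / - a.
  have s_ge0 : 0 <= s by rewrite divr_ge0 //; have := normr_ge0 b; lra.
  have sa : s * a = - (c + 1 + `|b|) by rewrite /s; field; lra.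
  have := q_ge0 (1 + s); have := q_ge0 (- (1 + s)); have := normr_ge0 b.
  have -> : (1 + s) ^+ 2 * a = a + 2 * (s * a) + s * (s * a) by ring.
  have -> : (- (1 + s)) ^+ 2 * a = a + 2 * (s * a) + s * (s * a) by ring.
  rewrite sa; nra.
have := q_ge0 (- b / a).
have -> : (- b / a) ^+ 2 * a + 2 * (- b / a) * b + c = (a * c - b ^+ 2) / a.
  by field.
by rewrite pmulr_lge0 ?invr_gt0 // subr_ge0.
Qed.

Section real_inner_product.
Context {R : realType} {V : lmodType R[i]}.

(** The form is only constrained on [D], so that one notion covers the vectors
    of a Hilbert space, its square summable sequences, and the elements of a
    von Neumann algebra under its trace. Only real parts of inner products are
    used: scalars are real although [V] is a complex space. *)
Record semi_inner (D : set V) (b : V -> V -> R) : Prop := SemiInner {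
  si0 : D 0;
  si_lin : forall (t : R) x y, D x -> D y -> D (t%:C *: x + y);
  si_sym : forall x y, D x -> D y -> b x y = b y x;
  si_linl : forall (t : R) x y z, D x -> D y -> D z ->
    b (t%:C *: x + y) z = t * b x z + b y z;
  si_ge0 : forall x, D x -> 0 <= b x x }.

Definition complete_for (D : set V) (b : V -> V -> R) : Prop :=
  forall u : nat -> V, (forall n, D (u n)) ->
    (forall e, 0 < e -> exists N, forall n m, (N <= n)%N -> (N <= m)%N ->
      b (u n - u m) (u n - u m) <= e) ->
    exists2 z, D z & forall e, 0 < e -> exists N, forall n, (N <= n)%N ->
      b (u n - z) (u n - z) <= e.

Definition adherent (W : set V) (b : V -> V -> R) (z : V) : Prop :=
  forall e, 0 < e -> exists2 w, W w & b (w - z) (w - z) <= e.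

Section theory.
Context (D : set V) (b : V -> V -> R) (bD : semi_inner D b).

Lemma siD x y : D x -> D y -> D (x + y).
Proof. by move=> Dx Dy; have := si_lin bD 1 Dx Dy; rewrite scale1r. Qed.

Lemma siZ t x : D x -> D (t%:C *: x).
Proof. by move=> Dx; have := si_lin bD t Dx (si0 bD); rewrite addr0. Qed.

Lemma siN x : D x -> D (- x).
Proof. by move=> Dx; have := siZ (-1) Dx; rewrite rmorphN1 scaleN1r. Qed.

Lemma siB x y : D x -> D y -> D (x - y).
Proof. by move=> Dx Dy; apply: siD => //; apply: siN. Qed.

Lemma siDl x y z : D x -> D y -> D z -> b (x + y) z = b x z + b y z.
Proof.
by move=> Dx Dy Dz; have := si_linl bD 1 Dx Dy Dz; rewrite scale1r mul1r.
Qed.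

Lemma si0l z : D z -> b 0 z = 0.
Proof.
move=> Dz; have := siDl (si0 bD) (si0 bD) Dz; rewrite addr0 => e0.
by apply: (@addrI _ (b 0 z)); rewrite addr0 -e0.
Qed.

Lemma siZl t x z : D x -> D z -> b (t%:C *: x) z = t * b x z.
Proof.
move=> Dx Dz; have := si_linl bD t Dx (si0 bD) Dz.
by rewrite !addr0 si0l // addr0.
Qed.

Lemma siNl x z : D x -> D z -> b (- x) z = - b x z.
Proof.
by move=> Dx Dz; have := siZl (-1) Dx Dz; rewrite rmorphN1 scaleN1r mulN1r.
Qed.

Lemma siBl x y z : D x -> D y -> D z -> b (x - y) z = b x z - b y z.
Proof. by move=> Dx Dy Dz; rewrite siDl ?siNl //; exact: siN. Qed.

Lemma siDr x y z : D x -> D y -> D z -> b z (x + y) = b z x + b z y.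
Proof.
move=> Dx Dy Dz; rewrite (si_sym bD) ?siDl //; last exact: siD.
by rewrite !(si_sym bD (y := z)).
Qed.

Lemma siZr t x z : D x -> D z -> b z (t%:C *: x) = t * b z x.
Proof.
move=> Dx Dz; rewrite (si_sym bD) ?siZl //; last exact: siZ.
by rewrite !(si_sym bD (y := z)).
Qed.

Lemma siNr x z : D x -> D z -> b z (- x) = - b z x.
Proof.
by move=> Dx Dz; have := siZr (-1) Dx Dz; rewrite rmorphN1 scaleN1r mulN1r.
Qed.

Lemma siBr x y z : D x -> D y -> D z -> b z (x - y) = b z x - b z y.
Proof. by move=> Dx Dy Dz; rewrite siDr ?siNr //; exact: siN. Qed.

Lemma si_sqrD t x y : D x -> D y ->
  b (t%:C *: x + y) (t%:C *: x + y) = t ^+ 2 * b x x + 2 * t * b x y + b y y.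
Proof.
move=> Dx Dy; have Dtx : D (t%:C *: x) by exact: siZ.
have Ds : D (t%:C *: x + y) by exact: siD.
rewrite siDl // siDr // siDr // !siZl // !siZr // (si_sym bD Dy Dx); ring.
Qed.

Lemma si_cauchy_schwarz x y : D x -> D y -> b x y ^+ 2 <= b x x * b y y.
Proof.
move=> Dx Dy; apply: discriminant_le => t; rewrite -si_sqrD //.
by apply: (si_ge0 bD); exact: (si_lin bD).
Qed.

Lemma si_triangle x y : D x -> D y ->
  Num.sqrt (b (x + y) (x + y)) <= Num.sqrt (b x x) + Num.sqrt (b y y).
Proof.
move=> Dx Dy; have /(_ x Dx) bx := si_ge0 bD; have /(_ y Dy) by_ := si_ge0 bD.
rewrite -(ger0_norm (addr_ge0 (sqrtr_ge0 (b x x)) (sqrtr_ge0 (b y y)))).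
rewrite -sqrtr_sqr; apply: ler_wsqrtr.
have := si_sqrD 1 Dx Dy; rewrite scale1r => ->.
have bxy : b x y <= Num.sqrt (b x x) * Num.sqrt (b y y).
  apply: le_trans (ler_norm _) _; rewrite -sqrtr_sqr -sqrtrM //.
  by apply: ler_wsqrtr; exact: si_cauchy_schwarz.
by rewrite sqrrD !sqr_sqrtr //; lra.
Qed.

Lemma si_sqrB_le x y : D x -> D y ->
  b (x + y) (x + y) <= 2 * b x x + 2 * b y y.
Proof.
move=> Dx Dy; have := si_sqrD 1 Dx Dy; have := si_sqrD (-1) Dx Dy.
have := si_ge0 bD (si_lin bD (-1) Dx Dy).
by rewrite rmorphN1 !scale1r => ? ? ->; lra.
Qed.

(** Minimising [b w w - 2 f w] over [W]: the parallelogram identity makes every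
    minimising sequence Cauchy, and the first variation at its limit is the
    equation that represents [f]. *)
Lemma riesz (W : set V) (f : V -> R) (C : R) :
  complete_for D b -> W `<=` D -> W 0 ->
  (forall (t : R) x y, W x -> W y -> W (t%:C *: x + y)) ->
  (forall (t : R) x y, W x -> W y -> f (t%:C *: x + y) = t * f x + f y) ->
  0 <= C -> (forall x, W x -> f x ^+ 2 <= C * b x x) ->
  exists z, [/\ D z, adherent W b z & forall w, W w -> b z w = f w].
Proof.
move=> cplt WD W0 Wlin flin C_ge0 fC.
pose J w := b w w - 2 * f w.
have JC w : W w -> - C <= J w.
  move=> Ww; have bw := si_ge0 bD (WD _ Ww); have := fC _ Ww; rewrite /J => fw.
  suff : f w <= (C + b w w) / 2 by lra.
  have [|f_ge0] := ltP (f w) 0; first by lra.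
  rewrite -ler_sqr ?nnegrE //; last by lra.
  by have := sqr_ge0 (C - b w w); lra.
have JW : has_inf [set J w | w in W].
  split; first by exists (J 0); exists 0.
  by exists (- C) => _ [w Ww <-]; exact: JC.
pose mJ := inf [set J w | w in W].
have mJ_le w : W w -> mJ <= J w.
  by move=> Ww; apply: ge_inf; [exact: JW.2|exists w].
have minimising n : exists2 w, W w & J w < mJ + n.+1%:R^-1.
  have n_gt0 : 0 < n.+1%:R^-1 :> R by rewrite invr_gt0.
  have [_ [w Ww <-] Jw] := inf_adherent n_gt0 JW.
  by exists w.
pose u n := projT1 (cid2 (minimising n)).
have uW n : W (u n) by rewrite /u; case: cid2.
have uJ n : J (u n) < mJ + n.+1%:R^-1 by rewrite /u; case: cid2.
have uD n : D (u n) by exact: WD.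
have WDlin t x y : W x -> W y -> D (t%:C *: x + y).
  by move=> Wx Wy; apply: WD; apply: Wlin.
have ucauchy n m : b (u n - u m) (u n - u m) <= 2 * (n.+1%:R^-1 + m.+1%:R^-1).
  have Wh : W ((2^-1)%:C *: u n + (2^-1)%:C *: u m).
    have := Wlin 2^-1 _ _ (uW m) W0; rewrite addr0 => Wm.
    exact: Wlin.
  have := mJ_le _ Wh; have := uJ n; have := uJ m; rewrite /J flin //; last first.
    by have := Wlin 2^-1 _ _ (uW m) W0; rewrite addr0.
  have -> : f ((2^-1)%:C *: u m) = 2^-1 * f (u m).
    have := flin 2^-1 _ _ (uW m) W0; rewrite addr0 => ->.
    have := flin (-1) _ _ W0 W0; rewrite scaler0 addr0 mulN1r addNr => ->.
    by rewrite addr0.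
  have DZ : D ((2^-1)%:C *: u m) by exact: siZ.
  rewrite si_sqrD // siZr // siZl // siZr //.
  have -> : u n - u m = (-1)%:C *: u m + u n by rewrite rmorphN1 scaleN1r addrC.
  rewrite si_sqrD // (si_sym bD (uD m) (uD n)).
  rewrite !exprS !expr0 !mulr1; move: (n.+1%:R^-1) (m.+1%:R^-1) => p q; lra.
have [||z Dz uz] := cplt u.
- exact: uD.
- move=> e e_gt0.
  have [N _ /(_ N (leqnn _))] := near_infty_natSinv_lt (PosNum (divr_gt0 e_gt0 (ltr0n _ 4))).
  rewrite /= => Ne; exists N => n m Nn Nm; apply: le_trans (ucauchy n m) _.
  have inv_le p : (N <= p)%N -> p.+1%:R^-1 <= N.+1%:R^-1 :> R.
    by move=> Np; rewrite lef_pV2 ?posrE // ler_nat ltnS.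
  have := inv_le _ Nn; have := inv_le _ Nm; move: Ne.
  by move: (n.+1%:R^-1) (m.+1%:R^-1) (N.+1%:R^-1) => p q r; lra.
exists z; split => //.
  move=> e e_gt0; have [N /(_ N (leqnn _)) ?] := uz e e_gt0.
  by exists (u N).
move=> w Ww; have Dw := WD _ Ww; have bw := si_ge0 bD Dw.
have un n : (b (u n) w - f w) ^+ 2 <= b w w * n.+1%:R^-1.
  apply: discriminant_le => t.
  have := mJ_le _ (Wlin t _ _ Ww (uW n)); have := uJ n.
  rewrite /J flin // si_sqrD // (si_sym bD Dw (uD n)).
  by move: (n.+1%:R^-1) => p; lra.
apply/eqP; rewrite -subr_eq0 -sqrf_eq0; apply/eqP; apply/le_anti/andP; split; last exact: sqr_ge0.
apply/ler_addgt0Pl => e e_gt0; rewrite addr0.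
pose d := e / (4 * (b w w + 1)).
have d_gt0 : 0 < d by rewrite divr_gt0 // mulr_gt0 //; lra.
have bd : 4 * (b w w * d) <= e.
  have -> : 4 * (b w w * d) = e * (b w w / (b w w + 1)).
    by rewrite /d; field; lra.
  by rewrite ger_pMr // ler_pdivrMr ?mul1r; lra.
have [N Nz] := uz d d_gt0.
have [N' _ /(_ (maxn N N'))] := near_infty_natSinv_lt (PosNum d_gt0).
rewrite /= leq_maxr => /(_ isT); set n := maxn N N' => nd.
have := Nz n (leq_maxl _ _); have := un n.
have := si_cauchy_schwarz (siB (uD n) Dz) Dw; rewrite siBl //.
move=> h1 h2 h3.
have h4 : (b (u n) w - b z w) ^+ 2 <= b w w * d.
  by apply: le_trans h1 _; rewrite mulrC ler_wpM2l.
have h5 : (b (u n) w - f w) ^+ 2 <= b w w * d.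
  by apply: le_trans h2 _; rewrite ler_wpM2l // ltW.
by move: (b (u n) w) (b z w) (f w) h4 h5 => p q r; have := sqr_ge0 (2 * p - q - r); lra.
Qed.

End theory.
End real_inner_product.

(** * Hilbert spaces as real inner product spaces *)

Lemma ltr0c (R : realType) (k : R) : (0 < k%:C) = (0 < k).
Proof. exact: (ltcR 0 k). Qed.

Section hilbert_space.
Context {R : realType} {H : hilbert R}.
Implicit Types (x y z : H) (T U V : H -> H).

(** The imaginary part of the inner product is recovered by multiplying a
    vector by [i], so the real part carries all the information. *)
Definition rin x y : R := complex.Re (inner x y).

Lemma innerDl x y z : inner (x + y) z = inner x z + inner y z.
Proof. by rewrite linearDl. Qed.

Lemma innerZl (c : R[i]) x z : inner (c *: x) z = c * inner x z.
Proof. by rewrite linearZl_LR. Qed.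

Lemma innerC x y : inner x y = conjc (inner y x).
Proof. by rewrite hermC expr0 mul1r. Qed.

Lemma innerDr x y z : inner z (x + y) = inner z x + inner z y.
Proof. by rewrite linearDr. Qed.

Lemma innerZr (c : R[i]) x z : inner z (c *: x) = conjc c * inner z x.
Proof. by rewrite linearZr_LR. Qed.

Lemma inner_self x : inner x x = (rin x x)%:C.
Proof.
rewrite /rin -norm_inner; apply/esym/RRe_real.
by rewrite realX // ger0_real.
Qed.

Lemma norm_rin x : `|x| = (Num.sqrt (rin x x))%:C.
Proof.
have := norm_inner x; rewrite inner_self => nx.
have := normr_ge0 x; rewrite lecE => /andP[/eqP nI nR].
have nE : `|x| = (complex.Re `|x|)%:C by apply/esym/RRe_real; rewrite ger0_real.
move: nx nR; rewrite {1 2 3}nE; move: (complex.Re _) => r.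
rewrite -rmorphXn => /complexI <- /= r_ge0.
by rewrite sqrtr_sqr ger0_norm.
Qed.

Lemma rin_ge0 x : 0 <= rin x x.
Proof.
rewrite -ler0c -inner_self -norm_inner; exact: exprn_ge0.
Qed.

Lemma rin_semi_inner : semi_inner [set: H] rin.
Proof.
split=> //.
- by move=> x y _ _; rewrite /rin innerC; case: (inner y x).
- move=> t x y z _ _ _; rewrite /rin innerDl innerZl.
  by case: (inner x z) (inner y z) => [a b] [c d] /=; simpc.
- by move=> x _; exact: rin_ge0.
Qed.

Lemma rin_eq0 x : rin x x = 0 -> x = 0.
Proof. by move=> x0; apply/normr0_eq0; rewrite norm_rin x0 sqrtr0. Qed.

Lemma rin_complete : complete_for [set: H] rin.
Proof.
move=> u _ uC.
have normE x : `|x| ^+ 2 = (rin x x)%:C by rewrite norm_inner inner_self.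
have le_norm x (e : R) : 0 < e -> rin x x <= e ^+ 2 -> `|x| <= e%:C.
  move=> e_gt0 xe; rewrite norm_rin lecR -(ger0_norm (ltW e_gt0)) -sqrtr_sqr.
  exact: ler_wsqrtr.
have cu : cvg (u @ \oo).
  apply/cauchy_cvgP/cauchy_exP => e e_gt0.
  have eE : e = (complex.Re e)%:C by apply/esym/RRe_real/gtr0_real.
  move: e_gt0; rewrite eE; move: (complex.Re e) => r {e eE}.
  rewrite ltr0c => r_gt0.
  have [N uN] := uC ((r / 2) ^+ 2) ltac:(by rewrite exprn_gt0 // divr_gt0).
  exists (u N), N => // n /= Nn; rewrite -ball_normE /=.
  apply: le_lt_trans (le_norm _ (r / 2) _ (uN _ _ (leqnn N) Nn)) _.
    by rewrite divr_gt0.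
  by rewrite ltcR; lra.
exists (limn u) => // e e_gt0.
have : 0 < (Num.sqrt e)%:C :> R[i] by rewrite ltr0c sqrtr_gt0.
move/cvgrPdist_le: (cu) => /[apply] -[N _ uN].
exists N => n /uN /=.
by rewrite distrC norm_rin lecR ler_sqrt // ltW.
Qed.

Lemma rin_sym x y : rin x y = rin y x.
Proof. exact: (si_sym rin_semi_inner). Qed.

Lemma rinDl x y z : rin (x + y) z = rin x z + rin y z.
Proof. exact: (siDl rin_semi_inner). Qed.

Lemma rinBl x y z : rin (x - y) z = rin x z - rin y z.
Proof. exact: (siBl rin_semi_inner). Qed.

Lemma rinZl (t : R) x z : rin (t%:C *: x) z = t * rin x z.
Proof. exact: (siZl rin_semi_inner). Qed.

Lemma rin_Im x y : complex.Im (inner x y) = - rin ('i%C *: x) y.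
Proof. by rewrite /rin innerZl; case: (inner x y) => a b /=; ring. Qed.

Lemma rin_inj x y : (forall z, rin x z = rin y z) -> x = y.
Proof.
move=> xy; apply/eqP; rewrite -subr_eq0; apply/eqP/rin_eq0.
by rewrite rinBl xy subrr.
Qed.

Lemma inner_rin_eq x y x' y' : rin x y = rin x' y' ->
  rin ('i%C *: x) y = rin ('i%C *: x') y' -> inner x y = inner x' y'.
Proof.
move=> re im; apply/eqP; rewrite eq_complex; apply/andP; split; apply/eqP => //.
by rewrite !rin_Im im.
Qed.

Lemma adjoint_unique T U V : adjoint_of T U -> adjoint_of T V -> U = V.
Proof.
move=> TU TV; apply/funext => y; apply: rin_inj => z.
by rewrite 2!(rin_sym _ z) /rin -TU -TV.
Qed.

Lemma adjE T U : adjoint_of T U -> adj T = U.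
Proof.
by move=> TU; apply: (adjoint_unique _ TU); rewrite /adj; case: xgetP => // /(_ U).
Qed.

Lemma adjoint_sym T U : adjoint_of T U -> adjoint_of U T.
Proof. by move=> TU x y; rewrite innerC -TU -innerC. Qed.

Lemma adjoint_comp T U T' U' : adjoint_of T T' -> adjoint_of U U' ->
  adjoint_of (T \o U) (U' \o T').
Proof. by move=> aT aU x y /=; rewrite aT aU. Qed.

Lemma adjoint_lin (c : R[i]) T U T' U' : adjoint_of T T' -> adjoint_of U U' ->
  adjoint_of (c \*: T \+ U) (conjc c \*: T' \+ U').
Proof.
move=> aT aU x y /=; rewrite innerDl innerDr innerZl innerZr conjcK.
by rewrite aT aU.
Qed.

Lemma bounded_opP T : bounded_operator T <->
  linear T /\ exists2 C, 0 <= C & forall x, rin (T x) (T x) <= C * rin x x.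
Proof.
split=> [[linT cT]|[linT [C C_ge0 TC]]]; split=> //.
  pose L := GRing.isLinear.Build _ _ _ _ T linT.
  pose f : {linear H -> H} := HB.pack T L.
  have /linear_boundedP [r [r_real fr]] : bounded_near f (nbhs (0 : H)).
    exact/linear_bounded_continuous.
  have /fr {}fr : r < (complex.Re r + 1)%:C.
    by rewrite -{1}(RRe_real r_real) ltcR; lra.
  exists ((complex.Re r + 1) ^+ 2) => [|x]; first exact: sqr_ge0.
  rewrite -lecR rmorphM rmorphXn /= -!inner_self -!norm_inner -exprMn.
  by rewrite lerXn2r ?nnegrE ?(le_trans _ (fr x)) //; exact: fr.
pose L := GRing.isLinear.Build _ _ _ _ T linT.
pose f : {linear H -> H} := HB.pack T L.
apply: (@bounded_linear_continuous _ _ _ f); apply/linear_boundedP.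
exists (Num.sqrt C)%:C; split; first by rewrite complex_real.
move=> r r_gt x; rewrite /= norm_rin.
apply: le_trans (_ : (Num.sqrt C)%:C * `|x| <= _); last first.
  by rewrite ler_wpM2r // ltW.
rewrite norm_rin -rmorphM lecR -sqrtrM //; exact: ler_wsqrtr.
Qed.

(** The value of the adjoint at [y] is the vector that represents the functional
    sending [x] to the real part of the inner product of [T x] and [y]. *)
Lemma bounded_adjoint T : bounded_operator T ->
  exists2 U, bounded_operator U & adjoint_of T U.
Proof.
move=> /bounded_opP[linT [C C_ge0 TC]].
have linTZ c x y : T (c *: x + y) = c *: T x + T y by exact: linT.
have T0 : T 0 = 0 by have := linTZ (-1) 0 0; rewrite !scaleN1r oppr0 addr0 addNr.
have TZ c x : T (c *: x) = c *: T x by have := linTZ c x 0; rewrite T0 !addr0.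
have rep y : exists z, forall w, rin z w = rin (T w) y.
  have [||||||z [_ _ zP]] := @riesz _ _ [set: H] rin rin_semi_inner setT
    (fun x => rin (T x) y) (C * rin y y) rin_complete => //.
  - by move=> t u v _ _; rewrite linTZ (si_linl rin_semi_inner).
  - exact: mulr_ge0 (rin_ge0 y).
  - move=> x _; rewrite mulrAC; apply: le_trans (_ : rin (T x) (T x) * rin y y <= _).
      exact: (si_cauchy_schwarz rin_semi_inner).
    by rewrite ler_wpM2r // rin_ge0.
  by exists z => w; exact: zP.
pose U y := projT1 (cid (rep y)).
have UP y w : rin w (U y) = rin (T w) y.
  by rewrite rin_sym /U; case: cid.
have TU : adjoint_of T U.
  by move=> x y; apply: inner_rin_eq; rewrite ?UP ?TZ.
have linU : linear U.
  move=> c x y; apply: rin_inj => z; rewrite rin_sym [RHS]rin_sym.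
  by rewrite /rin -TU !innerDr !innerZr !TU.
exists U => //; apply/bounded_opP; split=> //; exists C => // y.
have /= cs := si_cauchy_schwarz rin_semi_inner (x := T (U y)) (y := y) I I.
have := rin_ge0 (U y); have := rin_ge0 y; move: cs (TC (U y)).
rewrite -UP; move: (rin (U y) (U y)) (rin y y) (rin (T _) _) => p q r.
move=> pqr rCp q_ge0 p_ge0.
have [->|p_neq0] := eqVneq p 0; first exact: mulr_ge0.
have p_gt0 : 0 < p by rewrite lt_neqAle eq_sym p_neq0.
rewrite -(ler_pM2l p_gt0) -expr2; apply: le_trans pqr _.
by rewrite mulrCA mulrA ler_wpM2r.
Qed.

End hilbert_space.

(** * Square summable sequences of vectors *)

Section l2_sequences.
Context {R : realType} {H : hilbert R}.
Implicit Types (x y z : nat -> H).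

Definition l2_partial x y : R^nat := series (fun i => rin (x i) (y i)).
Definition l2 : set (nat -> H) :=
  [set x | exists C, forall N, l2_partial x x N <= C].
Definition l2_inner x y : R := limn (l2_partial x y).

Lemma l2_partial_nondecreasing x : nondecreasing_seq (l2_partial x x).
Proof.
by apply/nondecreasing_seqP => n; rewrite /l2_partial seriesSr lerDl rin_ge0.
Qed.

Lemma l2_self_cvg x : l2 x -> cvgn (l2_partial x x).
Proof.
move=> [C xC]; apply: nondecreasing_is_cvgn; first exact: l2_partial_nondecreasing.
by exists C => _ [n _ <-].
Qed.

Lemma l2_cvg x y : l2 x -> l2 y -> cvgn (l2_partial x y).
Proof.
move=> lx ly; apply: normed_cvg.
apply: (@series_le_cvg _ _ (fun i => rin (x i) (x i) + rin (y i) (y i))).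
- by move=> n; exact: normr_ge0.
- by move=> n; rewrite addr_ge0 ?rin_ge0.
- move=> n /=.
  have := si_cauchy_schwarz rin_semi_inner (x := x n) (y := y n) I I.
  have := rin_ge0 (x n); have := rin_ge0 (y n).
  move: (rin (x n) (x n)) (rin (y n) (y n)) (rin (x n) (y n)) => p q r.
  move=> q0 p0 rpq; rewrite -ler_sqr ?nnegrE ?addr_ge0 // real_normK ?num_real //.
  by apply: le_trans rpq _; nra.
rewrite -/(series _) seriesD; apply: is_cvgD; exact: l2_self_cvg.
Qed.

Lemma l2_inner_ge_partial x N : l2 x -> l2_partial x x N <= l2_inner x x.
Proof.
move=> lx; apply: nondecreasing_cvgn_le; last exact: l2_self_cvg.
exact: l2_partial_nondecreasing.
Qed.

Lemma l2_inner_le x C : (forall N, l2_partial x x N <= C) -> l2_inner x x <= C.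
Proof.
move=> xC; apply: limr_le; first by apply: l2_self_cvg; exists C.
by apply: nearW => n; exact: xC.
Qed.

Lemma l2_partial_lin (t : R) x y z :
  l2_partial (t%:C *: x + y) z = (fun N => t * l2_partial x z N + l2_partial y z N).
Proof.
apply/funext => N; rewrite /l2_partial /series /= mulr_sumr -big_split /=.
by apply: eq_bigr => i _; rewrite rinDl rinZl.
Qed.

Lemma l2_semi_inner : semi_inner l2 l2_inner.
Proof.
have l2_lin (t : R) x y : l2 x -> l2 y -> l2 (t%:C *: x + y).
  move=> [C xC] [C' yC']; exists (2 * (t ^+ 2 * C) + 2 * C') => N.
  apply: (@le_trans _ _ (2 * (t ^+ 2 * l2_partial x x N) + 2 * l2_partial y y N)).
    rewrite /l2_partial /series /= !mulr_sumr -big_split /=.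
    apply: ler_sum => i _.
    apply: le_trans (si_sqrB_le rin_semi_inner (x := t%:C *: x i) (y := y i) I I) _.
    by rewrite rinZl rin_sym rinZl; lra.
  have := yC' N; have := ler_wpM2l (sqr_ge0 t) (xC N); lra.
split=> //.
- by exists 0 => N; rewrite /l2_partial /series /= big1 // => i _; rewrite (si0l rin_semi_inner).
- move=> x y lx ly; rewrite /l2_inner /l2_partial; congr (limn (series _)).
  by apply/funext => i; exact: rin_sym.
- move=> t x y z lx ly lz; rewrite /l2_inner l2_partial_lin.
  apply: cvg_lim => //; apply: cvgD; last exact: l2_cvg.
  by apply: cvgM; [exact: cvg_cst|exact: l2_cvg].
- move=> x lx; apply: le_trans (l2_inner_ge_partial 0 lx).
  by rewrite /l2_partial /series /= big_geq.
Qed.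

Lemma rin_le_l2 x i : l2 x -> rin (x i) (x i) <= l2_inner x x.
Proof.
move=> lx; apply: le_trans (l2_inner_ge_partial i.+1 lx).
rewrite /l2_partial seriesSr lerDr sumr_ge0 // => j _; exact: rin_ge0.
Qed.

Lemma l2_inner_eq0 x : l2 x -> l2_inner x x = 0 -> x = 0.
Proof.
move=> lx x0; apply/funext => i; apply: rin_eq0; apply/le_anti.
by rewrite rin_ge0 andbT -x0 rin_le_l2.
Qed.

(** The limit is taken componentwise. Every partial sum of the squared distance
    to it is bounded by the Cauchy condition, and such a bound passes to the
    whole sum. *)
Lemma l2_complete : complete_for l2 l2_inner.
Proof.
move=> u ul uC.
have lB n m : l2 (u n - u m) by apply: (siB l2_semi_inner).
have /choice[z zP] : forall i, exists zi : H, forall e, 0 < e ->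
    exists N, forall n, (N <= n)%N -> rin (u n i - zi) (u n i - zi) <= e.
  move=> i; have [||zi _ zP] := @rin_complete _ _ (fun n => u n i) => //.
    move=> e /uC[N uN]; exists N => n m Nn Nm; apply: le_trans (uN _ _ Nn Nm).
    exact: (rin_le_l2 i (lB n m)).
  by exists zi.
have key e : 0 < e -> exists N, forall n, (N <= n)%N ->
    forall M, l2_partial (u n - z) (u n - z) M <= e.
  move=> e_gt0; have [N uN] := uC (e / 4) ltac:(by rewrite divr_gt0).
  exists N => n Nn M.
  have e'_gt0 : 0 < e / (4 * M.+1%:R) by rewrite divr_gt0 // mulr_gt0.
  have /choice[K KP] : forall i, exists K, forall n, (K <= n)%N ->
      rin (u n i - z i) (u n i - z i) <= e / (4 * M.+1%:R) by move=> i; exact: zP.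
  pose m := (N + \sum_(i < M) K i)%N.
  apply: (@le_trans _ _ (2 * l2_partial (u n - u m) (u n - u m) M
     + 2 * \sum_(0 <= i < M) e / (4 * M.+1%:R))).
    rewrite /l2_partial /series /= !mulr_sumr -big_split /= !big_mkord.
    apply: ler_sum => i _.
    have -> : (u n - z) i = (u n i - u m i) + (u m i - z i).
      by rewrite addrA subrK.
    apply: le_trans (si_sqrB_le rin_semi_inner I I) _; rewrite lerD2l ler_pM2l //.
    by apply: KP; rewrite /m (bigD1 i) //= addnCA leq_addr.
  have := l2_inner_ge_partial M (lB n m).
  have := uN n m Nn ltac:(by rewrite leq_addr).
  have : \sum_(0 <= i < M) e / (4 * M.+1%:R) <= e / 4.
    rewrite big_const_nat iter_addr addr0 subn0.
    have -> : e / (4 * M.+1%:R) *+ M = e / 4 * (M%:R / M.+1%:R).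
      by rewrite -[LHS]mulr_natr; field.
    rewrite ger_pMr; last by rewrite divr_gt0.
    by rewrite ler_pdivrMr // mul1r ler_nat.
  by move: (\sum_(0 <= i < M) _) (l2_partial _ _ _) (l2_inner _ _) => p q r; lra.
have lz : l2 z.
  have [N /(_ N (leqnn N)) uN] := key 1 ltr01.
  have lNz : l2 (u N - z) by exists 1.
  by have := siB l2_semi_inner (ul N) lNz; rewrite opprB addrCA subrr addr0.
exists z => // e /key[N uN]; exists N => n Nn; exact/l2_inner_le/uN.
Qed.

Lemma l2_op (T : H -> H) C x : (forall v, rin (T v) (T v) <= C * rin v v) ->
  0 <= C -> l2 x ->
  l2 (T \o x) /\ l2_inner (T \o x) (T \o x) <= C * l2_inner x x.
Proof.
move=> TC C_ge0 lx.
have TxC N : l2_partial (T \o x) (T \o x) N <= C * l2_inner x x.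
  apply: le_trans (_ : C * l2_partial x x N <= _); last first.
    by rewrite ler_wpM2l // l2_inner_ge_partial.
  by rewrite /l2_partial /series /= mulr_sumr ler_sum.
by split; [exists (C * l2_inner x x)|exact: l2_inner_le].
Qed.

Lemma l2_inner_adjoint (T U : H -> H) x y :
  adjoint_of T U -> l2_inner (T \o x) y = l2_inner x (U \o y).
Proof.
move=> TU; rewrite /l2_inner /l2_partial; congr (limn (series _)).
by apply/funext => i; rewrite /rin /= TU.
Qed.

Definition l2_single j (v : H) : nat -> H := fun i => if i == j then v else 0.
Definition l2_trunc N x : nat -> H := fun i => if (i < N)%N then x i else 0.

Lemma l2_truncS N x : l2_trunc N.+1 x = l2_trunc N x + l2_single N (x N).
Proof.
apply/funext => i; rewrite /l2_trunc /l2_single /GRing.add /=.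
rewrite ltnS leq_eqVlt; have [->|] := eqVneq i N; first by rewrite ltnn add0r.
by rewrite addr0.
Qed.

Lemma l2_trunc0 x : l2_trunc 0 x = 0.
Proof. by []. Qed.

Lemma l2_singleP j v :
  l2 (l2_single j v) /\ l2_inner (l2_single j v) (l2_single j v) <= rin v v.
Proof.
have le N : l2_partial (l2_single j v) (l2_single j v) N <= rin v v.
  rewrite /l2_partial /series /= big_mkord; have [jN|Nj] := ltnP j N.
    rewrite (bigD1 (Ordinal jN)) //= /l2_single eqxx big1 ?addr0 // => i ij.
    rewrite ifN ?(si0l rin_semi_inner) //.
  rewrite big1 ?rin_ge0 // => i _; rewrite /l2_single ifN ?(si0l rin_semi_inner) //.
  by rewrite neq_ltn (leq_trans (ltn_ord i) Nj).
by split; [exists (rin v v)|exact: l2_inner_le].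
Qed.

Lemma l2_truncP N x : l2 x -> l2 (l2_trunc N x).
Proof.
move=> lx; elim: N => [|N IHN]; first by rewrite l2_trunc0; exact: (si0 l2_semi_inner).
rewrite l2_truncS; apply: (siD l2_semi_inner) => //; exact: (l2_singleP _ _).1.
Qed.

Lemma l2_tail_small x e : l2 x -> 0 < e ->
  exists N, l2_inner (x - l2_trunc N x) (x - l2_trunc N x) <= e.
Proof.
move=> lx e_gt0; have := l2_self_cvg lx.
move=> /cvgrPdist_le/(_ _ e_gt0)[N _ /(_ N (leqnn N)) /= xN].
have := l2_inner_ge_partial N lx.
exists N; apply: l2_inner_le => M.

have tailE i : (x - l2_trunc N x) i = if (i < N)%N then 0 else x i.
  rewrite [LHS]/(x i - l2_trunc N x i) /l2_trunc.
  case: ifP => _; [exact: subrr|exact: subr0].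
have -> : l2_partial (x - l2_trunc N x) (x - l2_trunc N x) M =
    \sum_(N <= i < M) rin (x i) (x i).
  rewrite /l2_partial /series /=.
  have [NM|MN] := leqP N M.
    rewrite (big_cat_nat (n := N)) //= big_nat_cond big1 ?add0r; last first.
      by move=> i /andP[/andP[_ iN] _]; rewrite tailE iN (si0l rin_semi_inner).
    rewrite big_nat_cond [RHS]big_nat_cond.
    by apply: eq_bigr => i /andP[/andP[Ni _] _]; rewrite tailE ltnNge Ni.
  rewrite [RHS]big_geq 1?ltnW // big_nat_cond big1 // => i /andP[/andP[_ iM] _].
  by rewrite tailE (ltn_trans iM MN) (si0l rin_semi_inner).
have [NM|MN] := leqP N M; last by rewrite big_geq ?ltW // 1?ltnW.
have := l2_inner_ge_partial M lx.
have -> : l2_partial x x M = l2_partial x x N + \sum_(N <= i < M) rin (x i) (x i).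
  by rewrite /l2_partial /series /= -big_cat_nat.
have := le_trans (ler_norm _) xN; rewrite -/(l2_inner x x); lra.
Qed.

End l2_sequences.

(** * The bicommutant theorem *)

Section bicommutant.
Context {R : realType} {H : hilbert R}.
Implicit Types (x y z : nat -> H) (T U V P : H -> H).

Section density.
Context (A : set (H -> H)) (A_star : star_subalgebra A).
Context (zeta : nat -> H) (l2_zeta : l2 zeta).

Let orbit : set (nat -> H) := [set P \o zeta | P in A].

Let bnd P : A P -> exists2 C, 0 <= C & forall v, rin (P v) (P v) <= C * rin v v.
Proof. by move=> /(star_bounded A_star)/bounded_opP[]. Qed.

Lemma op_lin P : bounded_operator P -> forall (c : R[i]) u v, P (c *: u + v) = c *: P u + P v.
Proof. by move=> [linP _] c u v; exact: linP. Qed.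

Lemma op0 P : bounded_operator P -> P 0 = 0.
Proof.
by move=> bP; have := op_lin bP (-1) 0 0; rewrite !scaleN1r oppr0 addr0 addNr.
Qed.

Lemma opD P : bounded_operator P -> {morph P : u v / u + v}.
Proof. by move=> bP u v; have := op_lin bP 1 u v; rewrite !scale1r. Qed.

Lemma opZ P : bounded_operator P -> forall (c : R[i]) u, P (c *: u) = c *: P u.
Proof. by move=> bP c u; have := op_lin bP c u 0; rewrite (op0 bP) !addr0. Qed.

Lemma opN P : bounded_operator P -> {morph P : u / - u}.
Proof. by move=> bP u; have := opZ bP (-1) u; rewrite !scaleN1r. Qed.

Let orbit_l2 : orbit `<=` l2.
Proof. by move=> _ [P AP <-]; have [C C0 PC] := bnd AP; exact: (l2_op PC C0 l2_zeta).1. Qed.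

Let orbit_lin (t : R) x y : orbit x -> orbit y -> orbit (t%:C *: x + y).
Proof.
move=> [P AP <-] [Q AQ <-]; exists (t%:C \*: P \+ Q) => //; exact: star_lin.
Qed.

Let A_scalar (c : R[i]) : A (fun v => c *: v).
Proof.
have := star_lin A_star (c - 1) (star_one A_star) (star_one A_star).
congr A; apply/funext => v /=.
by rewrite scalerBl scale1r subrK.
Qed.

Let orbit0 : orbit 0.
Proof.
exists (fun v => 0 *: v); first exact: A_scalar.
by apply/funext => i /=; rewrite scale0r.
Qed.

Let is_proj x z := [/\ l2 z, adherent orbit l2_inner z &
  forall w, orbit w -> l2_inner z w = l2_inner x w].

Let bS := @l2_semi_inner R H.

Let is_proj_exists x : l2 x -> exists z, is_proj x z.
Proof.
move=> lx; apply: (riesz (C := l2_inner x x) bS l2_complete orbit_l2 orbit0) => //.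
- by move=> t y z /orbit_l2 ly /orbit_l2 lz; rewrite (siDr bS) ?(siZr bS) //; exact: (siZ bS).
- exact: (si_ge0 bS).
- by move=> w /orbit_l2 lw; exact: (si_cauchy_schwarz bS).
Qed.

Let orthogonal_adherent x z : l2 x -> l2 z -> adherent orbit l2_inner z ->
  (forall w, orbit w -> l2_inner x w = 0) -> l2_inner x z = 0.
Proof.
move=> lx lz az xW.
suff : l2_inner x z ^+ 2 <= 0.
  by move=> h; apply/eqP; rewrite -sqrf_eq0 eq_le h sqr_ge0.
apply/ler_addgt0Pl => e e_gt0; rewrite addr0.
have x_ge0 := si_ge0 bS lx.
have [|w Ww wz] := az (e / (l2_inner x x + 1)).
  by rewrite divr_gt0 //; lra.
have lw := orbit_l2 Ww.
have -> : l2_inner x z ^+ 2 = l2_inner x (w - z) ^+ 2.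
  by rewrite (siBr bS) // (xW w) // sub0r sqrrN.
apply: le_trans (si_cauchy_schwarz bS lx (siB bS lw lz)) _.
apply: le_trans (ler_wpM2l x_ge0 wz) _.
rewrite mulrCA ger_pMr // ler_pdivrMr ?mul1r; lra.
Qed.

Let is_proj_unique x z z' : l2 x -> is_proj x z -> is_proj x z' -> z = z'.
Proof.
move=> lx [lz az zx] [lz' az' z'x]; apply/eqP; rewrite -subr_eq0; apply/eqP.
have ld := siB bS lz lz'.
apply: l2_inner_eq0 => //.
have dW w : orbit w -> l2_inner (z - z') w = 0.
  by move=> Ww; rewrite (siBl bS) // ?zx ?z'x ?subrr //; exact: orbit_l2.
by rewrite (siBr bS) // !orthogonal_adherent ?subrr.
Qed.

Let is_proj_le x z : l2 x -> is_proj x z -> l2_inner z z <= l2_inner x x.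
Proof.
move=> lx [lz az zx].
have : l2_inner (z - x) z = 0.
  apply: orthogonal_adherent => //; first exact: (siB bS).
  by move=> w Ww; rewrite (siBl bS) ?zx ?subrr //; exact: orbit_l2.
rewrite (siBl bS) // => /eqP; rewrite subr_eq0 => /eqP zxz.
have := si_cauchy_schwarz bS lx lz; rewrite -zxz expr2.
have := si_ge0 bS lz; have := si_ge0 bS lx.
move: (l2_inner x x) (l2_inner z z) => p q p_ge0.
rewrite le_eqVlt => /predU1P[<- _ //|q_gt0].
by rewrite ler_pM2r.
Qed.

Let adherentD z z' : l2 z -> l2 z' -> adherent orbit l2_inner z ->
  adherent orbit l2_inner z' -> adherent orbit l2_inner (z + z').
Proof.
move=> lz lz' az az' e e_gt0.
have e4 : 0 < e / 4 by rewrite divr_gt0.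
have [w Ww wz] := az _ e4; have [w' Ww' wz'] := az' _ e4.
exists (w + w'); first by have := orbit_lin 1 Ww Ww'; rewrite scale1r.
have -> : w + w' - (z + z') = (w - z) + (w' - z') by rewrite opprD addrACA.
have := si_sqrB_le bS (siB bS (orbit_l2 Ww) lz) (siB bS (orbit_l2 Ww') lz').
lra.
Qed.

Let is_projD x y z z' : l2 x -> l2 y -> is_proj x z -> is_proj y z' ->
  is_proj (x + y) (z + z').
Proof.
move=> lx ly [lz az zx] [lz' az' z'y]; split.
- exact: (siD bS).
- exact: adherentD.
- move=> w Ww; have lw := orbit_l2 Ww.
  by rewrite !(siDl bS) // zx // z'y.
Qed.

Let is_proj_op P x z : A P -> l2 x -> is_proj x z -> is_proj (P \o x) (P \o z).
Proof.
move=> AP lx [lz az zx]; have [C C_ge0 PC] := bnd AP; split.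
- exact: (l2_op PC C_ge0 lz).1.
- move=> e e_gt0.
  have [|w Ww wz] := az (e / (C + 1)); first by rewrite divr_gt0 //; lra.
  exists (P \o w).
    by case: Ww => Q AQ <-; exists (P \o Q) => //; exact: star_mul.
  have -> : (P \o w) - (P \o z) = P \o (w - z).
    apply/funext => i /=; have bP := star_bounded A_star AP.
    by rewrite [in RHS]/GRing.add /= (opD bP) (opN bP).
  apply: le_trans (l2_op PC C_ge0 (siB bS (orbit_l2 Ww) lz)).2 _.
  apply: le_trans (ler_wpM2l C_ge0 wz) _.
  by rewrite mulrCA ger_pMr // ler_pdivrMr ?mul1r; lra.
- move=> _ [Q AQ <-]; have [P' AP' PP'] := star_adj A_star AP.
  rewrite !(l2_inner_adjoint _ _ PP'); apply: zx.
  by exists (P' \o Q) => //; exact: star_mul.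
Qed.

Let proj x : nat -> H := xget 0 (is_proj x).

Let projP x : l2 x -> is_proj x (proj x).
Proof.
by move=> /is_proj_exists[z xz]; rewrite /proj; case: xgetP => // /(_ z).
Qed.

Let projE x z : l2 x -> is_proj x z -> proj x = z.
Proof. by move=> lx; apply: is_proj_unique => //; exact: projP. Qed.

(** The projection on the closure of the orbit, seen as an infinite matrix of
    operators on [H]. *)
Let coef i j (v : H) : H := proj (l2_single j v) i.

Let coef_commutant i j : commutant A (coef i j).
Proof.
have coef_op P : A P -> P \o coef i j = coef i j \o P.
  move=> AP; apply/funext => v /=; rewrite /coef.
  have lv : l2 (l2_single j v) := (l2_singleP j v).1.
  have lPv : l2 (l2_single j (P v)) := (l2_singleP j _).1.
  rewrite (projE (z := P \o proj (l2_single j v)) lPv) //.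
  have -> : l2_single j (P v) = P \o l2_single j v.
    apply/funext => k /=; rewrite /l2_single; case: ifP => // _.
    exact: (esym (op0 (star_bounded A_star AP))).
  by apply: is_proj_op => //; exact: projP.
split; last by move=> P /coef_op.
have coefD u v : coef i j (u + v) = coef i j u + coef i j v.
  have lu : l2 (l2_single j u) := (l2_singleP j u).1.
  have lv : l2 (l2_single j v) := (l2_singleP j v).1.
  have luv : l2 (l2_single j (u + v)) := (l2_singleP j _).1.
  rewrite /coef (projE (z := proj (l2_single j u) + proj (l2_single j v)) luv) //.
  have -> : l2_single j (u + v) = l2_single j u + l2_single j v.
    apply/funext => k; rewrite [RHS]/GRing.add /= /l2_single.
    by case: ifP; rewrite ?addr0.
  by apply: is_projD => //; exact: projP.
apply/bounded_opP; split.
  move=> c u v; rewrite coefD; congr (_ + _).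
  by have /funeqP/(_ u) := coef_op _ (A_scalar c).
exists 1 => // v; rewrite mul1r.
have lv : l2 (l2_single j v) := (l2_singleP j v).1.
have [lp _ _] := projP lv.
apply: le_trans (rin_le_l2 i lp) _.
apply: le_trans (is_proj_le lv (projP lv)) _.
exact: (l2_singleP j v).2.
Qed.

(** On a truncated sequence only finitely many matrix coefficients act, and [T]
    commutes with each of them. *)
Let proj_trunc T N x : commutant (commutant A) T -> l2 x ->
  T \o proj (l2_trunc N x) = proj (l2_trunc N (T \o x)).
Proof.
move=> [bT TA] lx.
have [_ [C C_ge0 TC]] := (bounded_opP T).1 bT.
have lTx : l2 (T \o x) := (l2_op TC C_ge0 lx).1.
have proj0 : proj 0 = 0.
  apply: projE; first exact: (si0 bS).
  split => //; first exact: (si0 bS).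
  by move=> e e_gt0; exists 0 => //; rewrite subrr (si0l bS) ?ltW //; exact: (si0 bS).
elim: N => [|N IHN].
  by rewrite !l2_trunc0 proj0; apply/funext => i /=; rewrite (op0 bT).
have projS y : l2 y ->
    proj (l2_trunc N.+1 y) = proj (l2_trunc N y) + proj (l2_single N (y N)).
  move=> ly; have lt := l2_truncP N ly; have ls := (l2_singleP N (y N)).1.
  apply: projE; rewrite l2_truncS; first exact: (siD bS).
  by apply: is_projD => //; exact: projP.
rewrite !projS // -IHN; apply/funext => i.
rewrite [in RHS]/GRing.add /= [in LHS]/GRing.add /= (opD bT); congr (_ + _).
by have /funeqP/(_ (x N)) := TA _ (coef_commutant i N).
Qed.

(** The closure of the orbit of [zeta] in the square summable sequences is the
    range of a projection whose matrix coefficients commute with [A], hence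
    with [T]. As [zeta] lies in the orbit, its image by [T] lies in the closure.
    Sequences, rather than single vectors, are what normal functionals need. *)
Lemma bicommutant_dense T : commutant (commutant A) T ->
  forall e, 0 < e -> exists2 P, A P &
    l2_inner ((P \o zeta) - (T \o zeta)) ((P \o zeta) - (T \o zeta)) <= e.
Proof.
move=> TA e e_gt0; have [bT _] := TA.
have [_ [C C_ge0 TC]] := (bounded_opP T).1 bT.
have lT x : l2 x -> l2 (T \o x) by move=> lx; exact: (l2_op TC C_ge0 lx).1.
have projz : proj zeta = zeta.
  apply: projE => //; split=> // d d_gt0; exists zeta.
    by exists id => //; exact: star_one.
  by rewrite subrr (si0l bS) ?ltW //; exact: (si0 bS).
have d_gt0 : 0 < e / (4 * (C + 1)) by rewrite divr_gt0 // mulr_gt0 //; lra.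
have [N zN] := l2_tail_small l2_zeta d_gt0.
set r := zeta - l2_trunc N zeta in zN.
have lt := l2_truncP N l2_zeta.
have lr : l2 r := siB bS l2_zeta lt.
have [lpr _ _] := projP lr.
have lTt := l2_truncP N (lT _ l2_zeta).
have [lpt apt _] := projP lTt.
have TzE : T \o zeta = proj (l2_trunc N (T \o zeta)) + (T \o proj r).
  rewrite -(proj_trunc N TA l2_zeta).
  rewrite -{1}projz -{1}(subrK (l2_trunc N zeta) zeta) -/r addrC.
  rewrite (projE (z := proj (l2_trunc N zeta) + proj r) (siD bS lt lr)); last first.
    by apply: is_projD => //; exact: projP.
  by apply/funext => i; rewrite [RHS]/GRing.add /= [in LHS]/GRing.add /= (opD bT).
have [|_ [P AP <-] Pz] := apt (e / 4); first by rewrite divr_gt0.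
have lP : l2 (P \o zeta) by apply: orbit_l2; exists P.
exists P => //; rewrite TzE opprD addrA.
apply: le_trans (si_sqrB_le bS (siB bS lP lpt) (siN bS (lT _ lpr))) _.
have h1 := (l2_op TC C_ge0 lpr).2.
have h2 : C * l2_inner (proj r) (proj r) <= C * l2_inner r r.
  by rewrite ler_wpM2l // is_proj_le //; exact: projP.
have h3 : C * l2_inner r r <= e / 4.
  apply: le_trans (ler_wpM2l C_ge0 zN) _.
  have -> : C * (e / (4 * (C + 1))) = e / 4 * (C / (C + 1)) by field; lra.
  by rewrite ger_pMr ?divr_gt0 // ler_pdivrMr ?mul1r; lra.
rewrite (siNl bS) ?(siNr bS) ?opprK //; try exact: lT; last first.
  by apply: (siN bS); exact: lT.
lra.
Qed.

End density.

Lemma commutant_antitone (A B : set (H -> H)) :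
  A `<=` B -> commutant B `<=` commutant A.
Proof. by move=> AB T [bT TB]; split=> // U /AB; exact: TB. Qed.

Lemma sub_bicommutant (A : set (H -> H)) :
  A `<=` bounded_operator -> A `<=` commutant (commutant A).
Proof. by move=> Ab T AT; split=> [|U [_ UA]]; [exact: Ab|rewrite UA]. Qed.

Lemma bounded_operator_comp T U : bounded_operator T -> bounded_operator U ->
  bounded_operator (T \o U).
Proof.
move=> [lT cT] [lU cU]; split; first by move=> c u v /=; rewrite lU lT.
by move=> x; apply: continuous_comp; [exact: cU|exact: cT].
Qed.

Lemma bounded_operator_lin (c : R[i]) T U :
  bounded_operator T -> bounded_operator U -> bounded_operator (c \*: T \+ U).
Proof.
move=> [lT cT] [lU cU]; split.
  move=> d u v /=; rewrite lT lU !scalerDr !scalerA (mulrC c d).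
  by rewrite [RHS]addrACA.
by move=> x; apply: cvgD; [apply: cvgZr => //; exact: cT|exact: cU].
Qed.

(** The adjoint of [T] commutes with [P] because [T] commutes with the adjoint
    of [P]. *)
Lemma commutant_star (A : set (H -> H)) : A `<=` bounded_operator ->
  (forall T, A T -> exists2 U, A U & adjoint_of T U) ->
  star_subalgebra (commutant A).
Proof.
move=> A_bounded A_adj; split.
- by move=> T [].
- by split=> //; split=> [c u v //|x]; exact: cvg_id.
- move=> c T U [bT TA] [bU UA]; split; first exact: bounded_operator_lin.
  move=> P AP; have bP := A_bounded _ AP; apply/funext => v /=.
  rewrite (op_lin bP); congr (_ *: _ + _).
    by have /funeqP/(_ v) := TA _ AP.
  by have /funeqP/(_ v) := UA _ AP.
- move=> T U [bT TA] [bU UA]; split; first exact: bounded_operator_comp.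
  by move=> P AP; rewrite -compA UA // compA TA.
- move=> T [bT TA]; have [U bU TU] := bounded_adjoint bT.
  exists U => //; split=> // P AP; have [P' AP' PP'] := A_adj _ AP.
  apply: (adjoint_unique (T := P' \o T)).
    exact: adjoint_comp (adjoint_sym PP') TU.
  rewrite -TA //; exact: adjoint_comp TU (adjoint_sym PP').
Qed.

Lemma bicommutant_von_neumann (A : set (H -> H)) : star_subalgebra A ->
  von_neumann_algebra (commutant (commutant A)).
Proof.
move=> A_star.
have cA : star_subalgebra (commutant A).
  by apply: commutant_star; [exact: star_bounded|exact: star_adj].
split.
  by apply: commutant_star; [exact: star_bounded|exact: star_adj].
apply/seteqP; split; last by apply: sub_bicommutant => T [].
by apply: commutant_antitone; apply: sub_bicommutant => T [].
Qed.

End bicommutant.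

(** * The 2-norm and freeness in a tracial von Neumann algebra *)

Section generated.
Context {R : realType} {H : hilbert R}.
Implicit Types (B S : set (H -> H)).

(** Adjoints are unique, so the one that [B] provides belongs to every star
    subalgebra that contains [S]. *)
Lemma star_alg_star B S : star_subalgebra B -> S `<=` B ->
  star_subalgebra (star_alg S).
Proof.
move=> B_star SB; split.
- by move=> T /(_ B (conj B_star SB)); exact: star_bounded.
- by move=> C [C_star _]; exact: star_one.
- by move=> c T U ST SU C CS; apply: (star_lin CS.1); [exact: ST|exact: SU].
- by move=> T U ST SU C CS; apply: (star_mul CS.1); [exact: ST|exact: SU].
- move=> T ST; have [U BU TU] := star_adj B_star (ST _ (conj B_star SB)).
  exists U => // C CS; have [U' CU' TU'] := star_adj CS.1 (ST _ CS).
  by rewrite (adjoint_unique TU TU').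
Qed.

Lemma sub_star_alg S : S `<=` star_alg S.
Proof. exact: sub_smallest. Qed.

Lemma star_alg_min B S : star_subalgebra B -> S `<=` B -> star_alg S `<=` B.
Proof. by move=> B_star SB T; apply. Qed.

Lemma star_alg_le S S' : S `<=` S' -> star_alg S `<=` star_alg S'.
Proof. by move=> SS' T ST B [B_star S'B]; apply: ST; split=> //; exact: subset_trans S'B. Qed.

Lemma W_star_star B S : von_neumann_algebra B -> S `<=` B ->
  star_subalgebra (W_star S).
Proof.
move=> [B_star BB] SB; split.
- by move=> T /(_ B (conj (conj B_star BB) SB)); exact: star_bounded.
- by move=> C [[C_star _] _]; exact: star_one.
- by move=> c T U ST SU C CS; apply: (star_lin CS.1.1); [exact: ST|exact: SU].
- by move=> T U ST SU C CS; apply: (star_mul CS.1.1); [exact: ST|exact: SU].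
- move=> T ST; have [U BU TU] := star_adj B_star (ST _ (conj (conj B_star BB) SB)).
  exists U => // C CS; have [U' CU' TU'] := star_adj CS.1.1 (ST _ CS).
  by rewrite (adjoint_unique TU TU').
Qed.

Lemma W_star_bicommutant B S : star_subalgebra B -> S `<=` B ->
  W_star S `<=` commutant (commutant (star_alg S)).
Proof.
move=> B_star SB T; apply.
have S_star := star_alg_star B_star SB.
split; first exact: bicommutant_von_neumann.
apply: subset_trans (@sub_star_alg S) _.
by apply: sub_bicommutant; exact: star_bounded.
Qed.

End generated.

Lemma normc_le (R : realType) (z : R[i]) (r : R) :
  `|complex.Re z| <= r -> `|complex.Im z| <= r -> `|z| <= (2 * r)%:C.
Proof.
move=> re im; rewrite normc_def lecR.
have r_ge0 : 0 <= r := le_trans (normr_ge0 _) re.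
rewrite -(ger0_norm (_ : 0 <= 2 * r)) ?mulr_ge0 // -sqrtr_sqr.
apply: ler_wsqrtr.
have sq (x : R) : `|x| <= r -> x ^+ 2 <= r ^+ 2.
  by move=> xr; rewrite -real_normK ?num_real // ler_sqr ?nnegrE.
have := sq _ re; have := sq _ im; have := sqr_ge0 r; lra.
Qed.

Section tracial.
Context {R : realType} {M : tracialVNA R}.
Local Notation H := (vspace_of M).
Local Notation A := (vna M).
Local Notation tau := (trace M).
Implicit Types (T U V P : H -> H).

Lemma vna_star : star_subalgebra A.
Proof. exact: (vnaP M).1. Qed.

Lemma vna_bounded T : A T -> bounded_operator T.
Proof. exact: star_bounded vna_star T. Qed.

Lemma vna_adj T : A T -> A (adj T) /\ adjoint_of T (adj T).
Proof.
by move=> AT; have [U AU TU] := star_adj vna_star AT; rewrite (adjE TU).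
Qed.

Lemma vna0 : A 0.
Proof.
have := star_lin vna_star (-1) (star_one vna_star) (star_one vna_star).
by congr A; apply/funext => v /=; rewrite scaleN1r addNr.
Qed.

Lemma vna_lin (c : R[i]) T U : A T -> A U -> A (c *: T + U).
Proof. exact: (star_lin vna_star). Qed.

Lemma vnaZ (c : R[i]) T : A T -> A (c *: T).
Proof. by move=> AT; have := vna_lin c AT vna0; rewrite addr0. Qed.

Lemma vnaD T U : A T -> A U -> A (T + U).
Proof. by move=> AT AU; have := vna_lin 1 AT AU; rewrite scale1r. Qed.

Lemma vnaB T U : A T -> A U -> A (T - U).
Proof. by move=> AT AU; rewrite addrC -scaleN1r; exact: vna_lin. Qed.

Lemma vna_comp T U : A T -> A U -> A (T \o U).
Proof. exact: (star_mul vna_star). Qed.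

Lemma vna_id : A id.
Proof. exact: (star_one vna_star). Qed.

Lemma tau_lin (c : R[i]) T U : A T -> A U -> tau (c *: T + U) = c * tau T + tau U.
Proof. exact: (tr_lin (traceP M)). Qed.

Lemma tau0 : tau 0 = 0.
Proof.
have := tau_lin (-1) vna0 vna0.
by rewrite scaler0 addr0 mulN1r addNr.
Qed.

Lemma tauD T U : A T -> A U -> tau (T + U) = tau T + tau U.
Proof. by move=> AT AU; rewrite -{1}[T]scale1r tau_lin // mul1r. Qed.

Lemma tauZ (c : R[i]) T : A T -> tau (c *: T) = c * tau T.
Proof. by move=> AT; rewrite -[_ *: _]addr0 tau_lin ?tau0 ?addr0 //; exact: vna0. Qed.

Lemma tauB T U : A T -> A U -> tau (T - U) = tau T - tau U.
Proof. by move=> AT AU; rewrite addrC -scaleN1r tau_lin // mulN1r addrC. Qed.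

Lemma adj_lin (c : R[i]) T U : A T -> A U ->
  adj (c *: T + U) = conjc c *: adj T + adj U.
Proof.
move=> AT AU; apply: adjE.
by apply: adjoint_lin; [exact: (vna_adj AT).2|exact: (vna_adj AU).2].
Qed.

Lemma adj_comp T U : A T -> A U -> adj (T \o U) = adj U \o adj T.
Proof.
move=> AT AU; apply: adjE.
by apply: adjoint_comp; [exact: (vna_adj AT).2|exact: (vna_adj AU).2].
Qed.

Lemma adjK T : A T -> adj (adj T) = T.
Proof. by move=> AT; apply: adjE; apply: adjoint_sym; exact: (vna_adj AT).2. Qed.

Lemma adj_id : adj id = id :> (H -> H).
Proof. exact: adjE. Qed.

Lemma tau_self_Im T : A T -> complex.Im (tau (adj T \o T)) = 0.
Proof. by move=> AT; apply: ger0_Im; exact: (tr_pos (traceP M)). Qed.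

(** A positive functional is hermitian: expand its values at the squares of
    [T + id] and [i T + id], which are real. *)
Lemma tau_adj T : A T -> tau (adj T) = conjc (tau T).
Proof.
move=> AT; have [AT' TT'] := vna_adj AT.
have key (c : R[i]) : conjc c * c = 1 ->
    complex.Im (conjc c * tau (adj T) + c * tau T) = 0.
  move=> cc; have := tau_self_Im (vna_lin c AT vna_id).
  rewrite adj_lin ?adj_id //; last exact: vna_id.
  have -> : (conjc c *: adj T + id) \o (c *: T + id) =
     conjc c *: adj T + (c *: T + ((adj T \o T) + id)).
    apply/funext => v; rewrite [LHS]/GRing.add /= /GRing.scale /=.
    rewrite [LHS]/= (op_lin (vna_bounded AT')) scalerDr scalerA cc scale1r.
    rewrite [RHS]/GRing.add /= -!addrA addrCA; congr (_ + _).
    by rewrite addrCA.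
  have Ap := vna_comp AT' AT; have A1 := vnaD Ap vna_id.
  rewrite tau_lin //; last exact: vna_lin.
  rewrite tau_lin // tauD //; last exact: vna_id.
  rewrite (tr_one (traceP M)) !addrA => h; move: h.
  have := tau_self_Im AT; move: (tau (adj T \o T)) (_ * _ + _ * _) => [a b] [p q] /= ->.
  by rewrite !addr0.
have k1 : complex.Im (tau (adj T) + tau T) = 0.
  by have := key 1; rewrite conjc1 !mul1r; apply.
have k2 : complex.Re (tau T) = complex.Re (tau (adj T)).
  have ii : conjc 'i%C * 'i%C = 1 :> R[i] by simpc.
  have := key 'i%C ii; case: (tau T) (tau (adj T)) => a b [c d] /=; lra.
case: (tau T) (tau (adj T)) k1 k2 => a b [c d] /= h ->.
by congr (_ +i* _); lra.
Qed.

Definition tau_inner T U : R := complex.Re (tau (adj T \o U)).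

Lemma comp_linl (c : R[i]) T U V : (c *: T + U) \o V = c *: (T \o V) + (U \o V).
Proof. by []. Qed.

Lemma comp_linr (c : R[i]) T U V : A V ->
  V \o (c *: T + U) = c *: (V \o T) + (V \o U).
Proof. by move=> AV; apply/funext => v; exact: (op_lin (vna_bounded AV)). Qed.

Lemma tau_semi_inner : semi_inner A tau_inner.
Proof.
split.
- exact: vna0.
- by move=> t T U; exact: vna_lin.
- move=> T U AT AU; have [AT' _] := vna_adj AT; have [AU' _] := vna_adj AU.
  have := tau_adj (vna_comp AT' AU); rewrite adj_comp // adjK // /tau_inner => ->.
  by case: (tau _).
- move=> t T U V AT AU AV; rewrite /tau_inner adj_lin // conjc_real comp_linl.
  have [AT' _] := vna_adj AT; have [AU' _] := vna_adj AU.
  rewrite tau_lin; try exact: vna_comp.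
  by case: (tau (_ \o _)) (tau _) => [a b] [c d] /=; ring.
- move=> T AT; have := tr_pos (traceP M) AT.
  by rewrite lecE => /andP[].
Qed.

Lemma norm2E T : norm2 T = Num.sqrt (tau_inner T T).
Proof. by []. Qed.

Lemma norm2_ge0 T : 0 <= norm2 T.
Proof. exact: sqrtr_ge0. Qed.

Lemma norm2D T U : A T -> A U -> norm2 (T + U) <= norm2 T + norm2 U.
Proof. exact: (si_triangle tau_semi_inner). Qed.

Lemma norm2Z (t : R) T : A T -> norm2 (t%:C *: T) = `|t| * norm2 T.
Proof.
move=> AT; rewrite !norm2E (siZl tau_semi_inner) ?(siZr tau_semi_inner) //; last exact: vnaZ.
by rewrite mulrA -expr2 sqrtrM ?sqr_ge0 // sqrtr_sqr.
Qed.

Lemma norm2N T : A T -> norm2 (- T) = norm2 T.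
Proof. by move=> AT; have := norm2Z (-1) AT; rewrite rmorphN1 scaleN1r normrN1 mul1r. Qed.

Lemma norm2i T : A T -> norm2 ('i%C *: T) = norm2 T.
Proof.
move=> AT; rewrite /norm2; congr (Num.sqrt (complex.Re (tau _))).
have [AT' _] := vna_adj AT.
have -> : adj ('i%C *: T) = conjc 'i%C *: adj T.
  apply: adjE => x y; rewrite -[LHS]/(inner ('i%C *: T x) y).
  rewrite -[RHS]/(inner x (conjc 'i%C *: adj T y)) innerZl innerZr conjcK.
  by rewrite (vna_adj AT).2.
apply/funext => v /=; rewrite [LHS]/GRing.scale /= (opZ (vna_bounded AT')) scalerA.
by rewrite (_ : _ * _ = 1) ?scale1r //=; simpc.
Qed.

(** Cauchy-Schwarz for [tau_inner] bounds the real part; applied to [i U] it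
    bounds the imaginary part, whence the factor 2. *)
Lemma tau_cauchy_schwarz V U : A V -> A U ->
  `|tau (V \o U)| <= (2 * (norm2 (adj V) * norm2 U))%:C.
Proof.
move=> AV AU; have [AV' _] := vna_adj AV.
have re W : A W -> `|complex.Re (tau (V \o W))| <= norm2 (adj V) * norm2 W.
  move=> AW; have := si_cauchy_schwarz tau_semi_inner AV' AW.
  rewrite {1}/tau_inner adjK // => h.
  rewrite -sqrtr_sqr !norm2E -sqrtrM; first exact: ler_wsqrtr.
  exact: (si_ge0 tau_semi_inner).
apply: normc_le; first exact: re.
have := re _ (vnaZ 'i%C AU); rewrite norm2i //.
have -> : V \o ('i%C *: U) = 'i%C *: (V \o U).
  by apply/funext => v /=; exact: (opZ (vna_bounded AV)).
rewrite tauZ; last exact: vna_comp.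
by case: (tau _) => a b /=; rewrite mul0r mul1r sub0r normrN.
Qed.

(** Normality writes the trace of [adj T \o T] as the sum of the inner products
    of [T xi_i] and [T eta_i], which is at most half the sum of all the squared
    norms. Interleaving [xi] and [eta] turns this into a bound by a single
    sequence, to which the bicommutant theorem applies. *)
Lemma norm2_l2 : exists2 zeta : nat -> H, l2 zeta &
  forall T, A T -> norm2 T ^+ 2 <= l2_inner (T \o zeta) (T \o zeta).
Proof.
have [xi [eta [xiS etaS tauE]]] := tr_normal (traceP M).
have l2S (x : nat -> H) : square_summable x -> l2 x.
  move=> [C xC]; exists (complex.Re C) => N; have := xC N.
  have -> : \sum_(i < N) `|x i| ^+ 2 = (l2_partial x x N)%:C.
    rewrite /l2_partial /series /= big_mkord rmorph_sum; apply: eq_bigr => i _.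
    by rewrite norm_inner inner_self.
  by rewrite lecE => /andP[].
have {xiS} l2xi := l2S _ xiS; have {etaS} l2eta := l2S _ etaS.
pose mix (x y : nat -> H) i := if odd i then y i./2 else x i./2.
have mixE x y N : l2_partial (mix x y) (mix x y) N.*2 =
    l2_partial x x N + l2_partial y y N.
  elim: N => [|N IHN]; first by rewrite /l2_partial /series /= !big_geq // addr0.
  rewrite doubleS /l2_partial !seriesSr -!/(l2_partial _ _ _) IHN.
  rewrite /mix /= odd_double /= uphalf_double doubleK; lra.
have le2 x y N : l2_partial (mix x y) (mix x y) N <= l2_partial x x N + l2_partial y y N.
  rewrite -mixE; apply: l2_partial_nondecreasing.
  by rewrite -addnn leq_addr.
have l2mix x y : l2 x -> l2 y -> l2 (mix x y).
  by move=> [C xC] [C' yC']; exists (C + C') => N; apply: le_trans (le2 x y N) (lerD _ _).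
exists (mix xi eta) => [|T AT]; first exact: l2mix.
have [AT' TT'] := vna_adj AT.
rewrite norm2E sqr_sqrtr; last exact: (si_ge0 tau_semi_inner).
apply/ler_addgt0Pl => e e_gt0.
have e0 : 0 < e%:C :> R[i] by rewrite ltr0c.
have [N _ /(_ N (leqnn N)) /= h] := tauE _ (vna_comp AT' AT) _ e0.
have {}h : tau_inner T T <= e + l2_partial (T \o xi) (T \o eta) N.
  move/ltW: h; rewrite /l2_partial /series /= big_mkord.
  have -> : \sum_(i < N) rin (T (xi i)) (T (eta i)) =
      complex.Re (\sum_(i < N) inner ((adj T \o T) (xi i)) (eta i)).
    rewrite raddf_sum; apply: eq_bigr => i _ /=.
    by rewrite (adjoint_sym TT').
  move=> /(le_trans (normc_ge_Re _)); rewrite lecR.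
  rewrite raddfB /= => /ler_normlP[_]; rewrite /tau_inner; lra.
apply: le_trans h _; rewrite lerD2l.
have l2T : l2 (T \o mix xi eta).
  have [_ [C C_ge0 TC]] := (bounded_opP T).1 (vna_bounded AT).
  by apply: (l2_op TC C_ge0 _).1; exact: l2mix.
apply: le_trans (l2_inner_ge_partial N.*2 l2T).
have -> : T \o mix xi eta = mix (T \o xi) (T \o eta).
  by apply/funext => i /=; rewrite /mix; case: ifP.
rewrite mixE /l2_partial /series /= !big_mkord -big_split /=; apply: ler_sum => i _.
have := si_cauchy_schwarz rin_semi_inner (x := T (xi i)) (y := T (eta i)) I I.
have := rin_ge0 (T (xi i)); have := rin_ge0 (T (eta i)).
move: (rin (T (xi i)) _) (rin (T (xi i)) _) (rin _ _) => p q r r_ge0 q_ge0 pqr.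
nra.
Qed.

Lemma norm2_dense B T e : star_subalgebra B -> B `<=` A ->
  commutant (commutant B) T -> 0 < e ->
  A T /\ exists2 P, B P & norm2 (P - T) <= e.
Proof.
move=> B_star BA BT e_gt0.
have AT : A T.
  rewrite -(vnaP M).2; apply: (commutant_antitone _ BT).
  exact: commutant_antitone.
split=> //.
have [zeta l2z zP] := norm2_l2.
have [|P BP Pe] := bicommutant_dense B_star l2z BT (e := e ^+ 2).
  exact: exprn_gt0.
exists P => //; have AP := BA _ BP.
rewrite -ler_sqr ?nnegrE ?norm2_ge0 ?(ltW e_gt0) //.
exact: le_trans (zP _ (vnaB AP AT)) Pe.
Qed.

Lemma W_star_dense S T e : S `<=` A -> W_star S T -> 0 < e ->
  A T /\ exists2 P, star_alg S P & norm2 (P - T) <= e.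
Proof.
move=> SA ST; apply: norm2_dense.
- exact: star_alg_star vna_star SA.
- exact: star_alg_min vna_star SA.
- exact: W_star_bicommutant vna_star SA _ ST.
Qed.

Lemma prod_op_cat (J : Type) (v w : seq J) (a : J -> H -> H) :
  prod_op (v ++ w) a = prod_op v a \o prod_op w a.
Proof.
rewrite /prod_op; elim: v => [|j v IHv]; first by rewrite big_nil.
by rewrite /= !big_cons IHv.
Qed.

Lemma prod_op_cons (J : Type) j (w : seq J) (a : J -> H -> H) :
  prod_op (j :: w) a = a j \o prod_op w a.
Proof. by rewrite /prod_op big_cons. Qed.

Lemma vna_prod (J : eqType) (w : seq J) (a : J -> H -> H) :
  (forall j, j \in w -> A (a j)) -> A (prod_op w a).
Proof.
elim: w => [_|j w IHw Aa]; first by rewrite /prod_op big_nil; exact: vna_id.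
rewrite prod_op_cons; apply: vna_comp; first by apply: Aa; rewrite mem_head.
by apply: IHw => i iw; apply: Aa; rewrite inE iw orbT.
Qed.

(** The trace of a product is 2-norm continuous in each factor when the others
    are fixed, so the factors may be moved to the closures one at a time: [k]
    counts the factors already moved. *)
Lemma free_closure (J : Type) (F G : J -> set (H -> H)) :
  (forall j, F j `<=` A) ->
  (forall j T e, star_alg (G j) T -> 0 < e ->
    A T /\ exists2 P, star_alg (F j) P & norm2 (P - T) <= e) ->
  freely_independent (M := M) F -> freely_independent (M := M) G.
Proof.
move=> FA GF F_free n i a aG i_alt.
suff key k (c : nat -> H -> H) : (forall j, (j <= n)%N ->
    (if (j < k)%N then star_alg (G (i j)) (c j) else star_alg (F (i j)) (c j))
      /\ tau (c j) = 0) -> tau (prod_op (iota 0 n.+1) c) = 0.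
  by apply: (key n.+1) => j jn; rewrite ltnS jn; exact: aG.
have FjA j : star_alg (F j) `<=` A by apply: star_alg_min => //; exact: vna_star.
have Fj_star j := star_alg_star vna_star (FA j).
elim: k c => [|k IHk] c ck.
  by apply: (F_free n i) => // j jn; have := ck j jn; rewrite ltn0.
have [kn|nk] := leqP k n; last first.
  apply: IHk => j jn; have := ck j jn.
  by rewrite (leq_ltn_trans jn nk) (leq_ltn_trans jn (ltnW nk : n < k.+1)%N).
have Ac j : (j <= n)%N -> A (c j).
  move=> jn; have [] := ck j jn; case: ifP => _; last by move=> /FjA.
  by move=> /(GF _ _ 1) /(_ ltr01)[].
pose L := prod_op (iota 0 k) c; pose Q := prod_op (iota k.+1 (n - k)) c.
have prodE (c' : nat -> H -> H) : (forall j, j != k -> c' j = c j) ->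
    prod_op (iota 0 n.+1) c' = L \o (c' k \o Q).
  move=> cc'; have -> : n.+1 = (k + (n - k).+1)%N by rewrite addnS subnKC.
  rewrite iotaD add0n [iota k _]/= prod_op_cat prod_op_cons.
  have -> : prod_op (iota 0 k) c' = L.
    rewrite /L /prod_op big_seq [RHS]big_seq; apply: eq_bigr => j.
    by rewrite mem_iota => /andP[_ jk]; apply: cc'; rewrite neq_ltn jk.
  have -> // : prod_op (iota k.+1 (n - k)) c' = Q.
  rewrite /Q /prod_op big_seq [RHS]big_seq; apply: eq_bigr => j.
  by rewrite mem_iota => /andP[jk _]; apply: cc'; rewrite neq_ltn jk orbT.
have AL : A L.
  apply: vna_prod => j; rewrite mem_iota => /andP[_ jk]; apply: Ac.
  by apply: leq_trans (ltnW jk) _; rewrite add0n.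
have AQ : A Q.
  apply: vna_prod => j; rewrite mem_iota => /andP[_ jk]; apply: Ac.
  by move: jk; rewrite addSn subnKC // ltnS.
have AQL := vna_comp AQ AL.
have trE U : A U -> tau (L \o (U \o Q)) = tau ((Q \o L) \o U).
  by move=> AU; exact: (tr_tracial (traceP M) (vna_comp AL AU) AQ).
rewrite prodE // trE; last exact: Ac.
set K := 2 * norm2 (adj (Q \o L)) + 2 * norm2 (adj id : H -> H) * complex.Re `|tau (Q \o L)|.
have K_ge0 : 0 <= K.
  rewrite addr_ge0 ?mulr_ge0 ?norm2_ge0 //.
  by have := normr_ge0 (tau (Q \o L)); rewrite lecE => /andP[].
apply/normr0_eq0/le_anti; rewrite normr_ge0 andbT.
suff le_e e : 0 < e -> `|tau (Q \o L \o c k)| <= (K * e)%:C.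
  have := le_e _ ltr01; have zR := normr_ge0 (tau (Q \o L \o c k)).
  have zE : `|tau (Q \o L \o c k)| = (complex.Re `|tau (Q \o L \o c k)|)%:C.
    by apply/esym/RRe_real; rewrite ger0_real.
  rewrite zE (lecR _ 0) => _; apply/ler_addgt0Pl => e e_gt0; rewrite addr0.
  have := le_e (e / (K + 1)) ltac:(by rewrite divr_gt0 //; lra).
  rewrite zE lecR => /le_trans; apply.
  by rewrite mulrCA ger_pMr // ler_pdivrMr ?mul1r; lra.
move=> e_gt0; have [] := ck k kn; rewrite leqnn => Gc c0.
have [Ack [P FP Pc]] := GF _ _ _ Gc e_gt0.
have AP := FjA _ _ FP.
(* Centring keeps the approximation close, as [tau P] is close to [tau (c k)]. *)
pose P' := (- tau P) *: (id : H -> H) + P.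
have FP' : star_alg (F (i k)) P'.
  by apply: (star_lin (Fj_star _)) => //; exact: star_one.
have AP' := FjA _ _ FP'.
have P'0 : tau P' = 0.
  rewrite tau_lin // ?(tr_one (traceP M)) ?mulr1 ?addNr //; exact: vna_id.
have IH : tau (Q \o L \o P') = 0.
  rewrite -trE //; pose c' j := if j == k then P' else c j.
  have -> : P' = c' k by rewrite /c' eqxx.
  rewrite -prodE; last by move=> j jk; rewrite /c' (negbTE jk).
  apply: IHk => j jn; rewrite /c'; case: eqP => [->|/eqP jk].
    by rewrite ltnn.
  by have := ck j jn; rewrite ltnS leq_eqVlt (negbTE jk).
have Ad := vnaB AP Ack; set D := P - c k in Ad Pc.
have ckE : c k = (-1) *: D + (tau P *: id + P').
  by rewrite scaleN1r /P' scaleNr addNKr /D opprB subrK.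
have tauPD : tau P = tau D by rewrite tauB // c0 subr0.
have Ai := vna_id.
have -> : tau (Q \o L \o c k) = tau D * tau (Q \o L) - tau (Q \o L \o D).
  rewrite ckE (comp_linr _ _ _ AQL) (comp_linr _ _ _ AQL).
  have AQD := vna_comp AQL Ad; have AQP := vna_comp AQL AP'.
  rewrite (tau_lin _ AQD (vna_lin _ AQL AQP)) (tau_lin _ AQL AQP).
  by rewrite IH addr0 mulN1r addrC tauPD.
have QLD := tau_cauchy_schwarz AQL Ad; have iD := tau_cauchy_schwarz Ai Ad.
have zE : `|tau (Q \o L)| = (complex.Re `|tau (Q \o L)|)%:C.
  by apply/esym/RRe_real; rewrite ger0_real.
have z_ge0 : 0 <= complex.Re `|tau (Q \o L)|.
  by have := normr_ge0 (tau (Q \o L)); rewrite lecE => /andP[].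
apply: le_trans (ler_normB _ _) _; rewrite normrM zE.
apply: le_trans (lerD (ler_wpM2r _ iD) QLD) _; first by rewrite ler0c.
rewrite -rmorphM -rmorphD lecR /K.
have h1 := ler_wpM2l (norm2_ge0 (adj (Q \o L))) Pc.
have h2 := ler_wpM2r z_ge0 (ler_wpM2l (norm2_ge0 (adj id)) Pc).
move: h1 h2.
move: (norm2 D) (norm2 (adj (Q \o L))) (norm2 (adj id)) (complex.Re _) => p q r s.
lra.
Qed.
End tracial.

(** * Volume of a set with thin fibres *)

Section volume.
Context {R : realType}.
Implicit Types (J : finType).

Lemma geometric_half_lt2 N : \sum_(n < N) 2^-1 ^+ n < 2 :> R.
Proof.
suff -> : \sum_(n < N) 2^-1 ^+ n = 2 - 2 * 2^-1 ^+ N :> R.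
  have : 0 < 2^-1 ^+ N :> R by rewrite exprn_gt0 // invr_gt0.
  lra.
elim: N => [|N IHN]; first by rewrite big_ord0 expr0; lra.
rewrite big_ord_recr /= IHN exprSr; lra.
Qed.

(** A lattice path from a point is a sign and a number of steps in each of the
    [d] directions. Give a number [n] of steps the weight [2 * 2 ^- n]: a path
    with at most [d] steps has weight at least 1, and the total weight of all
    paths is a product of [d] factors, each at most 8. *)
Lemma card_steps J (d := #|J|) :
  #|[set f : {ffun J -> bool * 'I_d.+1} | (\sum_j (f j).2 <= d)%N]|%:R <= 8 ^+ d :> R.
Proof.
pose w (x : bool * 'I_d.+1) : R := 2 * 2^-1 ^+ x.2.
have w_ge0 x : 0 <= w x by rewrite mulr_ge0 ?exprn_ge0 ?invr_ge0.
apply: (@le_trans _ _ (\prod_(j : J) \sum_x w x)); last first.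
  rewrite prodr_const -/d lerXn2r ?nnegrE ?sumr_ge0 //.
  rewrite -(pair_big xpredT xpredT (fun (s : bool) (n : 'I_d.+1) => w (s, n))) /=.
  rewrite /w /= big_bool /= -mulr_sumr.
  have := geometric_half_lt2 d.+1; lra.
rewrite bigA_distr_bigA /= -sum1_card natr_sum.
rewrite [leRHS](bigID (mem [set f : {ffun J -> bool * 'I_d.+1} |
  (\sum_j (f j).2 <= d)%N])) /=.
rewrite -[leLHS]addr0; apply: lerD; last first.
  by apply: sumr_ge0 => f _; apply: prodr_ge0.
apply: ler_sum => f; rewrite inE => fd.
rewrite /w big_split /= prodr_const -/d prodrXr exprVn.
by rewrite ler_pdivlMr ?exprn_gt0 // mul1r ler_eXn2l ?ltr1n.
Qed.

Lemma grid_interval (lo hi x : R) N : (0 < N)%N -> lo <= x <= hi ->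
  exists p : 'I_N, lo + (hi - lo) * (p%:R / N%:R) <= x <=
                   lo + (hi - lo) * (p.+1%:R / N%:R).
Proof.
case: N => // N _ /andP[lox xhi].
have P0 : lo + (hi - lo) * ((@ord0 N)%:R / N.+1%:R) <= x by rewrite mul0r mulr0 addr0.
case: (@arg_maxnP _ ord0 (fun p : 'I_N.+1 => lo + (hi - lo) * (p%:R / N.+1%:R) <= x)
  (fun p => nat_of_ord p) P0) => p px pmax.
exists p; rewrite px /=; have [pN|Np] := ltnP p.+1 N.+1; last first.
  have -> : p.+1 = N.+1 by apply/eqP; rewrite eqn_leq Np ltn_ord.
  by rewrite divff // mulr1 addrC subrK.
rewrite leNgt; apply/negP => /ltW /(pmax (Ordinal pN)) /=.
by rewrite ltnn.
Qed.

Lemma step_interval (h x y : R) : 0 < h ->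
  exists sn : bool * nat, sn.2%:R * h <= `|y - x| /\
    x + (if sn.1 then sn.2%:R * h else - (sn.2.+1%:R * h)) <= y <=
    x + (if sn.1 then sn.2.+1%:R * h else - (sn.2%:R * h)).
Proof.
move=> h_gt0; pose n := Num.truncn (`|y - x| / h).
have /andP[] : n%:R <= `|y - x| / h < n.+1%:R.
  by apply: truncn_itv; rewrite divr_ge0 // ltW.
rewrite ler_pdivlMr // ltr_pdivrMr // => n1 n2.
exists (x <= y, n); split => //=.
have [xy|yx] := leP x y.
  by move: n1 n2; rewrite ger0_norm ?subr_ge0 //; lra.
by move: n1 n2; rewrite ltr0_norm ?subr_lt0 //; lra.
Qed.

Definition in_box J (B : (J -> R) * (J -> R)) (x : J -> R) : Prop :=
  forall j, B.1 j <= x j <= B.2 j.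
Definition box_vol J (B : (J -> R) * (J -> R)) : R := \prod_j (B.2 j - B.1 j).

(** Countably many finite lists of boxes form one countable cover, indexed by the
    codes of the pairs of a list and a position in it. *)
Lemma lebesgue_vol_cover J (A : set (J -> R)) (D : set nat)
    (s : nat -> seq ((J -> R) * (J -> R))) (v : nat -> R) :
  (forall l B, B \in s l -> forall j, B.1 j <= B.2 j) ->
  (forall x, A x -> exists2 l, D l & exists2 B, B \in s l & in_box B x) ->
  (forall l, D l -> \sum_(B <- s l) box_vol B <= v l) ->
  (lebesgue_vol A <= \esum_(l in D) (v l)%:E)%E.
Proof.
move=> s_le As sv.
pose B0 : (J -> R) * (J -> R) := (fun=> 0, fun=> 0).
pose box (k : nat * nat) := nth B0 (s k.1) k.2.
pose K := D `*`` (fun l => [set i | (i < size (s l))%N]).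
pose bx n := if unpickle n is Some k then box k else B0.
have bxK k : bx (pickle k) = box k by rewrite /bx pickleK.
have box_le k j : (box k).1 j <= (box k).2 j.
  rewrite /box; have [k_lt|k_ge] := ltnP k.2 (size (s k.1)).
    by apply: s_le; exact: mem_nth.
  by rewrite nth_default.
have box_ge0 k : 0 <= box_vol (box k).
  by apply: prodr_ge0 => j _; rewrite subr_ge0.
apply: (@le_trans _ _ (\esum_(n in pickle @` K) (box_vol (bx n))%:E)).
  apply: ereal_inf_lbound; exists (pickle @` K), (fun n => (bx n).1), (fun n => (bx n).2).
  split=> //.
    by move=> l j; rewrite /bx; case: unpickle => [k|]; [exact: box_le|].
  move=> x /As[l Dl [B Bs Bx]]; exists (pickle (l, index B (s l))).
    by exists (l, index B (s l)) => //; split => //=; rewrite index_mem.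
  by move=> j; rewrite bxK /box /= nth_index.
rewrite esum_image; last by apply: in2W; exact: (pcan_inj pickleK).
under eq_esum do rewrite bxK.
rewrite -(@esum_esum _ _ _ D (fun l => [set i | (i < size (s l))%N])
  (fun l i => (box_vol (box (l, i)))%:E)) //; last first.
  by move=> *; rewrite lee_fin.
apply: le_esum => l Dl.
rewrite esum_fset //; last by move=> *; rewrite lee_fin.
rewrite -fsbig_ord sumEFin lee_fin; apply: le_trans (sv l Dl).
by rewrite (big_nth B0) big_mkord.
Qed.

Lemma esum_mulr_le (T : choiceType) (D : set T) (f : T -> R) (c : R) :
  0 <= c -> (forall i, 0 <= f i) ->
  (\esum_(i in D) (f i * c)%:E <= (\esum_(i in D) (f i)%:E) * c%:E)%E.
Proof.
move=> c_ge0 f_ge0; apply: ge_ereal_sup => _ [X DX <-].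
have -> : (\sum_(i \in X) (f i * c)%:E = (\sum_(i \in X) (f i)%:E) * c%:E)%E.
  under eq_fsbigr do rewrite EFinM.
  by rewrite -ge0_mule_fsuml // => i; rewrite lee_fin.
apply: lee_wpmul2r; first by rewrite lee_fin.
by apply: ereal_sup_ubound; exists X.
Qed.

(** Over a cell of side at most [eta] the fibres of [G] all lie within the
    [l1]-distance [h * #|J2|] of any point of one of them, so they are covered by
    the at most [8 ^ #|J2|] cubes of side [h] that are reached from this point in
    [#|J2|] steps. Cutting the boxes of a cover of [G1] into such cells does not
    change their total volume. *)
Lemma lebesgue_vol_fibre (J1 J2 : finType) (G : set (J1 + J2 -> R))
    (G1 : set (J1 -> R)) (h eta : R) :
  0 < h -> 0 < eta ->
  (forall x, G x -> G1 (x \o inl)) ->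
  (forall x y, G x -> G y -> (forall j, `|x (inl j) - y (inl j)| <= eta) ->
    \sum_j `|x (inr j) - y (inr j)| <= h * #|J2|%:R) ->
  (lebesgue_vol G <= lebesgue_vol G1 * ((8 * h) ^+ #|J2|)%:E)%E.
Proof.
move=> h_gt0 eta_gt0 GG1 Gnear.
have c_gt0 : 0 < (8 * h) ^+ #|J2| by rewrite exprn_gt0 // mulr_gt0.
rewrite -lee_pdivrMr //.
apply: le_ereal_inf_tmp => _ [D [a [b [ab cover ->]]]].
rewrite lee_pdivrMr //.
apply: le_trans (esum_mulr_le _ (ltW c_gt0) _); last first.
  by move=> l; apply: prodr_ge0 => j _; rewrite subr_ge0.
pose d := #|J2|.
(* The box [l] is cut into [N l] slices in each direction. *)
pose N l := (Num.truncn (\sum_j (b l j - a l j) / eta)).+1.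
have width_ge0 l j : 0 <= b l j - a l j by rewrite subr_ge0.
have width l j : (b l j - a l j) / (N l)%:R <= eta.
  rewrite ler_pdivrMr // mulrC -ler_pdivrMr //.
  apply: le_trans (ltW (truncnS_gt _)); rewrite (bigD1 j) //= lerDl.
  by apply: sumr_ge0 => i _; rewrite divr_ge0 // ltW.
pose cell l (p : {ffun J1 -> 'I_(N l)}) : (J1 -> R) * (J1 -> R) :=
  (fun j => a l j + (b l j - a l j) * ((p j)%:R / (N l)%:R),
   fun j => a l j + (b l j - a l j) * ((p j).+1%:R / (N l)%:R)).
(* A point of some fibre over the cell; a cell without one needs no cover, and
   the default value is then harmless. *)
pose centre l p : J2 -> R :=
  xget (fun=> 0) [set c | exists x : J1 + J2 -> R,
    [/\ G x, in_box (cell l p) (x \o inl) & x \o inr = c]].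
pose cube (c : J2 -> R) (m : {ffun J2 -> bool * 'I_d.+1}) : (J2 -> R) * (J2 -> R) :=
  (fun j => c j + (if (m j).1 then (m j).2%:R * h else - ((m j).2.+1%:R * h)),
   fun j => c j + (if (m j).1 then (m j).2.+1%:R * h else - ((m j).2%:R * h))).
pose pair_box (B : (J1 -> R) * (J1 -> R)) (C : (J2 -> R) * (J2 -> R)) :
    (J1 + J2 -> R) * (J1 + J2 -> R) :=
  ((fun j => match j with inl i => B.1 i | inr i => C.1 i end),
   (fun j => match j with inl i => B.2 i | inr i => C.2 i end)).
pose M := [set f : {ffun J2 -> bool * 'I_d.+1} | (\sum_j (f j).2 <= d)%N].
pose s l := [seq pair_box (cell l p) (cube (centre l p) m) |
  p <- enum {ffun J1 -> 'I_(N l)}, m <- enum M].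
apply: (@lebesgue_vol_cover _ _ _ s).
- move=> l B /allpairsP[[p m] /= [_ _ ->]] [j|j] /=.
    by rewrite lerD2l ler_wpM2l // ler_wpM2r ?invr_ge0 // ler_nat.
  by rewrite lerD2l; case: ifP => _; rewrite ?lerN2 ler_wpM2r ?(ltW h_gt0) // ler_nat.
- move=> x Gx; have [l Dl /= xl] := cover _ (GG1 _ Gx); exists l => //.
  have /choice[p pP] := fun j => grid_interval (ltn0Sn _ : (0 < N l)%N) (xl j).
  pose P := [ffun j => p j].
  have xP : in_box (cell l P) (x \o inl) by move=> j /=; rewrite !ffunE.
  have [y [Gy yP yc]] : exists y : J1 + J2 -> R,
      [/\ G y, in_box (cell l P) (y \o inl) & y \o inr = centre l P].
    rewrite /centre; case: xgetP => [_ -> // |/(_ (x \o inr))[]].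
    by exists x.
  have close : \sum_j `|x (inr j) - centre l P j| <= h * d%:R.
    rewrite -yc; apply: Gnear => // j.
    have := xP j; have := yP j; have := width l j; rewrite /= ffunE.
    have -> : (p j).+1%:R / (N l)%:R = (p j)%:R / (N l)%:R + (N l)%:R^-1 :> R.
      by rewrite -natr1 mulrDl mul1r.
    rewrite mulrDr => w /andP[y1 y2] /andP[x1 x2].
    by apply/ler_normlP; split; lra.
  have /choice[m mP] := fun j => step_interval (centre l P j) (x (inr j)) h_gt0.
  have m_le : (\sum_j (m j).2 <= d)%N.
    rewrite -(ler_nat R) natr_sum -(ler_pM2r h_gt0) mulr_suml [leRHS]mulrC.
    apply: le_trans close; apply: ler_sum => j _; exact: (mP j).1.
  have m_lt j : ((m j).2 < d.+1)%N.
    by rewrite ltnS; apply: leq_trans m_le; rewrite (bigD1 j) //= leq_addr.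
  pose m' := [ffun j => ((m j).1, Ordinal (m_lt j))].
  exists (pair_box (cell l P) (cube (centre l P) m')).
    apply/allpairsP; exists (P, m'); split => //=; first by rewrite mem_enum.
    rewrite mem_enum inE; apply: leq_trans m_le.
    by rewrite leq_eqVlt; apply/orP; left; apply/eqP/eq_bigr => j _; rewrite ffunE.
  move=> [j|j] /=; first exact: xP.
  by rewrite !ffunE /=; exact: (mP j).2.
- move=> l Dl; pose V := \prod_j (b l j - a l j).
  have N_gt0 : 0 < (N l)%:R :> R by rewrite ltr0n.
  have volE p m : box_vol (pair_box (cell l p) (cube (centre l p) m)) =
      V * (N l)%:R ^- #|J1| * h ^+ d.
    rewrite /box_vol big_sumType /=; congr (_ * _).
      rewrite -exprVn -prodr_const -big_split /=; apply: eq_bigr => j _.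
      by rewrite -(@natr1 R (p j)); field; exact: lt0r_neq0.
    rewrite -[RHS]prodr_const; apply: eq_bigr => j _.
    by case: ifP => _; rewrite -(@natr1 R (m j).2); ring.
  rewrite big_allpairs_dep.
  under eq_bigr do under eq_bigr do rewrite volE.
  rewrite big_enum /= sumr_const big_enum /= sumr_const card_ffun card_ord.
  have V_ge0 : 0 <= V by apply: prodr_ge0.
  rewrite -mulrnA -[leLHS]mulr_natr natrM natrX.
  have -> : V * (N l)%:R ^- #|J1| * h ^+ d * (#|M|%:R * (N l)%:R ^+ #|J1|) =
      V * (#|M|%:R * h ^+ d).
    by field; rewrite expf_neq0 // lt0r_neq0.
  rewrite ler_wpM2l // exprMn ler_wpM2r ?exprn_ge0 ?(ltW h_gt0) //.
  exact: card_steps.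
Qed.

End volume.

(** * Noncommutative polynomials in operators and in matrices *)

Section nc_polynomials.
Context {R : realType}.

(** Coefficients and words, possibly with repetitions: only the values matter. *)
Definition ncpoly (J : Type) := seq (R[i] * seq J).
Definition ncpoly_scale J (c : R[i]) (Q : ncpoly J) : ncpoly J :=
  [seq (c * t.1, t.2) | t <- Q].
Definition ncpoly_mul J (Q Q' : ncpoly J) : ncpoly J :=
  [seq (t.1 * t'.1, t.2 ++ t'.2) | t <- Q, t' <- Q'].
Definition ncpoly_star J (Q : ncpoly J) : ncpoly J :=
  [seq (conjc t.1, rev t.2) | t <- Q].
Definition ncpoly_map J J' (f : J -> J') (Q : ncpoly J) : ncpoly J' :=
  [seq (t.1, map f t.2) | t <- Q].
Definition ncpoly_degree J (Q : ncpoly J) : nat := \max_(t <- Q) size t.2.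

Section operators.
Context {M : tracialVNA R} (J : choiceType) (Z : J -> op M).
Local Notation H := (vspace_of M).
Hypothesis Z_sa : forall j, sa_element (Z j).

Definition ncpoly_op (Q : ncpoly J) : H -> H :=
  \sum_(t <- Q) t.1 *: (prod_op t.2 Z : H -> H).

Lemma vna_word w : vna M (prod_op w Z).
Proof. by apply: vna_prod => j _; exact: (Z_sa j).1. Qed.

Lemma ncpoly_op_cons t Q :
  ncpoly_op (t :: Q) = t.1 *: (prod_op t.2 Z : H -> H) + ncpoly_op Q.
Proof. by rewrite /ncpoly_op big_cons. Qed.

Lemma ncpoly_op_cat Q Q' : ncpoly_op (Q ++ Q') = ncpoly_op Q + ncpoly_op Q'.
Proof. by rewrite /ncpoly_op big_cat. Qed.

Lemma vna_ncpoly Q : vna M (ncpoly_op Q).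
Proof.
elim: Q => [|t Q IHQ]; first by rewrite /ncpoly_op big_nil; exact: vna0.
by rewrite ncpoly_op_cons; apply: vna_lin => //; exact: vna_word.
Qed.

Lemma ncpoly_op_scale c Q : ncpoly_op (ncpoly_scale c Q) = c *: ncpoly_op Q.
Proof.
rewrite /ncpoly_op big_map scaler_sumr; apply: eq_bigr => t _.
by rewrite scalerA.
Qed.

Lemma ncpoly_op_mul Q Q' : ncpoly_op (ncpoly_mul Q Q') = ncpoly_op Q \o ncpoly_op Q'.
Proof.
elim: Q => [|t Q IHQ]; first by rewrite /ncpoly_op !big_nil.
rewrite /ncpoly_mul /= ncpoly_op_cat IHQ ncpoly_op_cons comp_linl; congr (_ + _).
rewrite {IHQ}; elim: Q' => [|t' Q' IHQ'].
  rewrite /ncpoly_op !big_nil; apply/funext => v /=.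
  by rewrite [RHS]/GRing.scale /= (op0 (vna_bounded (vna_word _))) scaler0.
rewrite /= !ncpoly_op_cons (comp_linr _ _ _ (vna_word _)) IHQ' scalerDr scalerA /=.
by rewrite prod_op_cat.
Qed.

Lemma adjoint_word w : adjoint_of (prod_op w Z) (prod_op (rev w) Z).
Proof.
elim: w => [|j w IHw]; first by rewrite /prod_op !big_nil.
rewrite prod_op_cons rev_cons -cats1 prod_op_cat.
rewrite [prod_op [:: j] Z]/prod_op big_cons big_nil.
exact: adjoint_comp (Z_sa j).2 IHw.
Qed.

Lemma adjoint_ncpoly Q : adjoint_of (ncpoly_op Q) (ncpoly_op (ncpoly_star Q)).
Proof.
elim: Q => [|t Q IHQ].
  by rewrite /ncpoly_op !big_nil => x y; rewrite /inner linear0l linear0r.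
rewrite /= !ncpoly_op_cons; exact: adjoint_lin (adjoint_word _) IHQ.
Qed.

Lemma tau_ncpoly Q :
  trace M (ncpoly_op Q) = \sum_(t <- Q) t.1 * trace M (prod_op t.2 Z).
Proof.
elim: Q => [|t Q IHQ]; first by rewrite /ncpoly_op !big_nil tau0.
rewrite ncpoly_op_cons big_cons tau_lin ?IHQ //; first exact: vna_word.
exact: vna_ncpoly.
Qed.

Lemma star_alg_ncpoly T : star_alg (range Z) T -> exists Q, T = ncpoly_op Q.
Proof.
pose B : set (H -> H) := [set U | vna M U /\ exists Q, U = ncpoly_op Q].
suff : star_alg (range Z) `<=` B by move=> /[apply] -[].
apply: star_alg_min; last first.
  move=> _ [j _ <-]; split; first exact: (Z_sa j).1.
  exists [:: (1, [:: j])].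
  by rewrite ncpoly_op_cons /ncpoly_op big_nil addr0 scale1r /prod_op big_cons big_nil.
split.
- by move=> U [AU _]; exact: vna_bounded.
- split; first exact: vna_id.
  exists [:: (1, [::])].
  by rewrite ncpoly_op_cons /ncpoly_op big_nil addr0 scale1r /prod_op big_nil.
- move=> c U V [AU [Q QU]] [AV [Q' QV]]; split; first exact: vna_lin.
  by exists (ncpoly_scale c Q ++ Q'); rewrite ncpoly_op_cat ncpoly_op_scale -QU -QV.
- move=> U V [AU [Q QU]] [AV [Q' QV]]; split; first exact: vna_comp.
  by exists (ncpoly_mul Q Q'); rewrite ncpoly_op_mul -QU -QV.
- move=> U [AU [Q QU]]; exists (ncpoly_op (ncpoly_star Q)).
    by split; [exact: vna_ncpoly|exists (ncpoly_star Q)].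
  by rewrite QU; exact: adjoint_ncpoly.
Qed.

End operators.

Lemma ncpoly_op_map {M : tracialVNA R} (J J' : choiceType) (f : J -> J')
    (Z : J' -> op M) Q : ncpoly_op Z (ncpoly_map f Q) = ncpoly_op (Z \o f) Q.
Proof.
rewrite /ncpoly_op big_map; apply: eq_bigr => t _.
by rewrite /prod_op big_map.
Qed.

Section matrices.
Context (k : nat) (J : Type).
Implicit Types (A : J -> 'M[R[i]]_k) (Q : ncpoly J).

Definition ncpoly_mx A Q : 'M[R[i]]_k := \sum_(t <- Q) t.1 *: prod_mx t.2 A.

Definition adjoint_mx (B : 'M[R[i]]_k) : 'M[R[i]]_k := map_mx Num.conj B^T.

Lemma prod_mx_cons j w A : prod_mx (j :: w) A = A j *m prod_mx w A.
Proof. by rewrite /prod_mx big_cons. Qed.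

Lemma prod_mx_cat v w A : prod_mx (v ++ w) A = prod_mx v A *m prod_mx w A.
Proof.
elim: v => [|j v IHv]; first by rewrite /prod_mx big_nil mul1mx.
by rewrite /= !prod_mx_cons IHv mulmxA.
Qed.

Lemma ncpoly_mx_mul A Q Q' :
  ncpoly_mx A (ncpoly_mul Q Q') = ncpoly_mx A Q *m ncpoly_mx A Q'.
Proof.
rewrite /ncpoly_mx /ncpoly_mul big_allpairs_dep mulmx_suml; apply: eq_bigr => t _.
rewrite mulmx_sumr; apply: eq_bigr => t' _ /=.
by rewrite -scalemxAl -scalemxAr scalerA prod_mx_cat.
Qed.

Lemma adjoint_mx_mul (B C : 'M[R[i]]_k) :
  adjoint_mx (B *m C) = adjoint_mx C *m adjoint_mx B.
Proof. by rewrite /adjoint_mx trmx_mul map_mxM. Qed.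

Lemma adjoint_mx_word A w : (forall j, adjoint_mx (A j) = A j) ->
  adjoint_mx (prod_mx w A) = prod_mx (rev w) A.
Proof.
move=> A_sa; elim: w => [|j w IHw].
  by rewrite /prod_mx big_nil /adjoint_mx trmx1 map_mx1.
rewrite prod_mx_cons adjoint_mx_mul IHw A_sa rev_cons -cats1 prod_mx_cat.
by rewrite [prod_mx [:: j] A]/prod_mx big_cons big_nil mulmx1.
Qed.

Lemma adjoint_mx_ncpoly A Q : (forall j, adjoint_mx (A j) = A j) ->
  adjoint_mx (ncpoly_mx A Q) = ncpoly_mx A (ncpoly_star Q).
Proof.
move=> A_sa; rewrite /ncpoly_mx big_map /adjoint_mx.
rewrite (raddf_sum (trmx : 'M[R[i]]_k -> _)) (raddf_sum (map_mx _ : 'M[R[i]]_k -> _)) /=.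
apply: eq_bigr => t _; rewrite linearZ /= map_mxZ; congr (_ *: _).
exact: adjoint_mx_word.
Qed.

Lemma mxtrace_adjoint_mul (B : 'M[R[i]]_k) :
  \tr (adjoint_mx B *m B) = \sum_a \sum_b `|B a b| ^+ 2.
Proof.
rewrite exchange_big /=; apply: eq_bigr => b _; rewrite mxE; apply: eq_bigr => a _.
by rewrite !mxE normCK mulrC.
Qed.

(** The constants depend on [k] in a crude way: for each [k] they only serve to
    choose the mesh of a subdivision. *)
Lemma word_bounded (r : R[i]) (w : seq J) : 0 <= r -> exists2 C : R[i], 0 <= C &
  forall A, (forall j a b, `|A j a b| <= r) -> forall a b, `|prod_mx w A a b| <= C.
Proof.
move=> r_ge0; elim: w => [|j w [C C_ge0 CP]].
  exists 1 => // A _ a b; rewrite /prod_mx big_nil mxE.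
  by rewrite normr_nat; case: (a == b).
exists (r * C *+ k) => [|A Ar a b]; first by rewrite mulrn_wge0 // mulr_ge0.
rewrite prod_mx_cons mxE; apply: le_trans (ler_norm_sum _ _ _) _.
rewrite -[k in leRHS]card_ord -sumr_const; apply: ler_sum => c _.
by rewrite normrM ler_pM //; exact: CP.
Qed.

Lemma word_lipschitz (r : R[i]) (w : seq J) : 0 <= r -> exists2 L : R[i], 0 <= L &
  forall (A B : J -> 'M[R[i]]_k) (eta : R[i]), 0 <= eta ->
    (forall j a b, `|A j a b| <= r) -> (forall j a b, `|B j a b| <= r) ->
    (forall j a b, `|A j a b - B j a b| <= eta) ->
    forall a b, `|prod_mx w A a b - prod_mx w B a b| <= L * eta.
Proof.
move=> r_ge0; elim: w => [|j w [L L_ge0 LP]].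
  exists 0 => // A B eta _ _ _ _ a b.
  by rewrite /prod_mx !big_nil subrr normr0 mul0r.
have [C C_ge0 CP] := word_bounded w r_ge0.
exists ((C + r * L) *+ k) => [|A B eta eta_ge0 Ar Br AB a b].
  by rewrite mulrn_wge0 // addr_ge0 // mulr_ge0.
rewrite !prod_mx_cons !mxE -sumrB; apply: le_trans (ler_norm_sum _ _ _) _.
rewrite mulrnAl -[k in leRHS]card_ord -sumr_const; apply: ler_sum => c _.
have -> : A j a c * prod_mx w A c b - B j a c * prod_mx w B c b =
   (A j a c - B j a c) * prod_mx w A c b
     + B j a c * (prod_mx w A c b - prod_mx w B c b) by ring.
apply: le_trans (ler_normD _ _) _; rewrite !normrM mulrDl lerD //.
  by rewrite mulrC ler_pM //; exact: CP.
by rewrite -mulrA ler_pM //; exact: LP.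
Qed.

Lemma ncpoly_lipschitz (r : R[i]) Q : 0 <= r -> exists2 L : R[i], 0 <= L &
  forall (A B : J -> 'M[R[i]]_k) (eta : R[i]), 0 <= eta ->
    (forall j a b, `|A j a b| <= r) -> (forall j a b, `|B j a b| <= r) ->
    (forall j a b, `|A j a b - B j a b| <= eta) ->
    forall a b, `|ncpoly_mx A Q a b - ncpoly_mx B Q a b| <= L * eta.
Proof.
move=> r_ge0; elim: Q => [|t Q [L L_ge0 LP]].
  exists 0 => // A B eta _ _ _ _ a b.
  by rewrite /ncpoly_mx !big_nil subrr normr0 mul0r.
have [L' L'_ge0 LP'] := word_lipschitz t.2 r_ge0.
exists (`|t.1| * L' + L) => [|A B eta eta_ge0 Ar Br AB a b].
  by rewrite addr_ge0 // mulr_ge0.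
rewrite /ncpoly_mx !big_cons -!/(ncpoly_mx _ _) !mxE opprD addrACA.
apply: le_trans (ler_normD _ _) _; rewrite mulrDl lerD //; last exact: LP.
by rewrite -mulrBr normrM -mulrA ler_wpM2l //; exact: LP'.
Qed.

End matrices.

(** The factor by which an error on the moments of words is amplified. *)
Definition ncpoly_mass (J : Type) (Q : ncpoly J) : R[i] := \sum_(t <- Q) `|t.1|.

Lemma ncpoly_moment {M : tracialVNA R} (J : finType) (Z : J -> op M) (r : R)
    (l k : nat) (e : R) (A : J -> 'M[R[i]]_k) (Q : ncpoly J) :
  (forall j, sa_element (Z j)) -> microstates Z r l e A ->
  (ncpoly_degree Q <= l)%N ->
  `|k%:R^-1 * \tr (ncpoly_mx A Q) - trace M (ncpoly_op Z Q)| <= ncpoly_mass Q * e%:C.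
Proof.
move=> Z_sa [_ _ Am]; rewrite tau_ncpoly // /ncpoly_degree /ncpoly_mass.
elim: Q => [_|t Q IHQ].
  by rewrite /ncpoly_mx !big_nil mxtrace0 mulr0 subrr normr0 mul0r.
rewrite !big_cons geq_max => /andP[tl /IHQ {}IHQ].
rewrite /ncpoly_mx big_cons -/(ncpoly_mx _ _) mxtraceD mxtraceZ mulrDr opprD addrACA.
apply: le_trans (ler_normD _ _) _; rewrite mulrDl lerD //.
rewrite mulrCA -mulrBr normrM ler_wpM2l //.
by apply: ltW; exact: Am.
Qed.

End nc_polynomials.

(** * Coordinates of hermitian matrices *)

Section hermitian_coordinates.
Context {R : realType} (k : nat).
Local Notation P := ('I_k * 'I_k)%type.

Lemma herm_mxB (x y : P -> R) :
  herm_mx x - herm_mx y = herm_mx (fun p => x p - y p).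
Proof.
apply/matrixP => a b; rewrite !mxE.
case: eqP => _; first by rewrite -rmorphB.
by case: ifP => _; simpc; congr (_ +i* _); ring.
Qed.

Lemma normsq_herm_mx (x : P -> R) a b :
  `|herm_mx x a b| ^+ 2 = ((x (a, b) ^+ 2 + x (b, a) ^+ 2) / 2)%:C.
Proof.
have s2 : Num.sqrt 2 ^+ 2 = 2 :> R by rewrite sqr_sqrtr.
have s2_neq0 : Num.sqrt 2 != 0 :> R by rewrite sqrtr_eq0 -ltNge.
rewrite -add_Re2_Im2; congr _%:C; rewrite mxE.
have sq (u v : R) : (u / Num.sqrt 2) ^+ 2 + (v / Num.sqrt 2) ^+ 2 = (u ^+ 2 + v ^+ 2) / 2.
  by rewrite !exprMn exprVn s2 mulrDl.
case: eqP => [->|_] /=; first by rewrite expr0n /= addr0; field.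
by case: ifP => _ /=; rewrite ?sqrrN sq // addrC.
Qed.

Lemma sum_normsq_herm_mx (x : P -> R) :
  \sum_a \sum_b `|herm_mx x a b| ^+ 2 = (\sum_p x p ^+ 2)%:C.
Proof.
under eq_bigr do under eq_bigr do rewrite normsq_herm_mx.
rewrite (eq_bigr (fun a => (\sum_b (x (a, b) ^+ 2 + x (b, a) ^+ 2) / 2)%:C)); last first.
  by move=> a _; rewrite rmorph_sum.
rewrite -rmorph_sum /=; congr _%:C.
have sumE : \sum_p x p ^+ 2 = \sum_a \sum_b x (a, b) ^+ 2.
  by rewrite pair_big /=; apply: eq_bigr => -[].
have -> : \sum_a \sum_b (x (a, b) ^+ 2 + x (b, a) ^+ 2) / 2 =
    (\sum_a \sum_b x (a, b) ^+ 2 + \sum_a \sum_b x (b, a) ^+ 2) / 2.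
  rewrite -big_split /= mulr_suml; apply: eq_bigr => a _.
  by rewrite -mulr_suml -big_split.
by rewrite [X in (_ + X) / 2]exchange_big /= -sumE; field.
Qed.

Lemma herm_mx_near (x : P -> R) (eta : R) : (forall p, `|x p| <= eta) ->
  forall a b, `|herm_mx x a b| <= (2 * eta)%:C.
Proof.
move=> xe a b; have eta_ge0 : 0 <= eta := le_trans (normr_ge0 _) (xe (a, b)).
have h : `|herm_mx x a b| ^+ 2 <= ((2 * eta)%:C) ^+ 2.
  rewrite normsq_herm_mx -rmorphXn lecR.
  have sq p : x p ^+ 2 <= eta ^+ 2.
    by rewrite -(real_normK (num_real (x p))) ler_sqr ?nnegrE.
  have := sq (a, b); have := sq (b, a); have := sqr_ge0 eta; lra.
by move: h; rewrite ler_sqr ?nnegrE // ler0c mulr_ge0.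
Qed.

End hermitian_coordinates.

Lemma opnorm_le_entry (R : realType) k (A : 'M[R[i]]_k) (r : R) : 0 <= r ->
  opnorm_le A r -> forall a b, `|A a b| <= r%:C.
Proof.
move=> r_ge0 Ar a b; have := Ar (delta_mx b 0).
have -> : \sum_c `|(delta_mx b 0 : 'cV[R[i]]_k) c 0| ^+ 2 = 1.
  rewrite (bigD1 b) //= mxE !eqxx normr1 expr1n big1 ?addr0 // => c cb.
  by rewrite mxE (negbTE cb) normr0 expr0n.
rewrite mulr1 (bigD1 a) //= => h.
have {h} : `|A a b| ^+ 2 <= (r%:C) ^+ 2.
  rewrite -[leRHS]rmorphXn; apply: le_trans h.
  have -> : (A *m (delta_mx b 0 : 'cV[R[i]]_k)) a 0 = A a b.
    rewrite mxE (bigD1 b) //= big1 => [|c cb].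
      by rewrite addr0 mxE !eqxx mulr1.
    by rewrite mxE (negbTE cb) mulr0.
  by rewrite lerDl sumr_ge0 // => c _; rewrite exprn_ge0.
by rewrite ler_sqr ?nnegrE // ler0c.
Qed.

Section volumes.
Context {R : realType}.

Lemma lebesgue_vol_ge0 (J : finType) (A : set (J -> R)) : (0 <= lebesgue_vol A)%E.
Proof.
apply: le_ereal_inf_tmp => _ [D [a [b [ab _ ->]]]]; apply: esum_ge0 => l _.
by rewrite lee_fin; apply: prodr_ge0 => j _; rewrite subr_ge0.
Qed.

Lemma lebesgue_vol_reindex (J J' : finType) (f : J' -> J) (g : J -> J')
    (A : set (J -> R)) : cancel f g -> cancel g f ->
  (lebesgue_vol A <= lebesgue_vol [set y : J' -> R | A (y \o g)])%E.
Proof.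
move=> fK gK; apply: le_ereal_inf_tmp => _ [D [a [b [ab cover ->]]]].
apply: ereal_inf_lbound; exists D, (fun l => a l \o g), (fun l => b l \o g).
split=> [l j|x Ax|]; first exact: ab.
  have [|l Dl xl] := cover (x \o f).
    by rewrite /=; congr A: Ax; apply/funext => j /=; rewrite gK.
  by exists l => // j; have := xl (g j); rewrite /= gK.
apply: eq_esum => l _; congr _%:E.
by rewrite (reindex g) //; apply: onW_bij; exists f.
Qed.

(** This is [lebesgue_vol_fibre] once the coordinates [(I1 + I2) * P] are split
    as [I1 * P + I2 * P]; the distance over [I2 * P] is the sum over [I2]. *)
Lemma herm_vol_fibre (I1 I2 : finType) (k : nat)
    (G : set (I1 + I2 -> 'M[R[i]]_k)) (G1 : set (I1 -> 'M[R[i]]_k)) (h eta : R) :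
  0 < h -> 0 < eta ->
  (forall A, G A -> G1 (A \o inl)) ->
  (forall x y : (I1 + I2) -> 'I_k * 'I_k -> R,
    G (fun i => herm_mx (x i)) -> G (fun i => herm_mx (y i)) ->
    (forall i p, `|x (inl i) p - y (inl i) p| <= eta) ->
    forall j, \sum_p `|x (inr j) p - y (inr j) p| <= h * (k * k)%:R) ->
  (herm_vol G <= herm_vol G1 * ((8 * h) ^+ (#|I2| * (k * k)))%:E)%E.
Proof.
move=> h_gt0 eta_gt0 GG1 Gnear.
pose g (ip : (I1 + I2) * ('I_k * 'I_k)) : I1 * ('I_k * 'I_k) + I2 * ('I_k * 'I_k) :=
  match ip.1 with inl i => inl (i, ip.2) | inr i => inr (i, ip.2) end.
pose f (s : I1 * ('I_k * 'I_k) + I2 * ('I_k * 'I_k)) : (I1 + I2) * ('I_k * 'I_k) :=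
  match s with inl ip => (inl ip.1, ip.2) | inr ip => (inr ip.1, ip.2) end.
have fK : cancel f g by case=> [[i p]|[i p]].
have gK : cancel g f by case=> [[i|i] p].
apply: le_trans (lebesgue_vol_reindex _ fK gK) _.
have -> : (#|I2| * (k * k))%N = #|{: I2 * ('I_k * 'I_k)}|.
  by rewrite !card_prod card_ord.
apply: (lebesgue_vol_fibre h_gt0 eta_gt0) => [x /= /GG1|x y Gx Gy xy].
  by [].
have := Gnear (fun i p => x (g (i, p))) (fun i p => y (g (i, p))) Gx Gy.
move=> /(_ (fun i p => xy (i, p))) near.
rewrite (eq_bigr (fun jp => (fun j p =>
  `|x (inr (j, p)) - y (inr (j, p))|) jp.1 jp.2)); last by case.
rewrite -(pair_big xpredT xpredT (fun j p => `|x (inr (j, p)) - y (inr (j, p))|)) /=.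
apply: le_trans (ler_sum _ (fun j _ => near j)) _.
rewrite sumr_const !card_prod card_ord -[leLHS]mulr_natr !natrM.
by rewrite (_ : _ * _ * _ = h * (#|I2|%:R * (k%:R * k%:R))) //; ring.
Qed.

End volumes.

(** * Fibres of the spaces of relative microstates *)

Lemma sum_normr_le (R : realType) (T : finType) (z : T -> R) (s : R) : 0 < s ->
  \sum_p z p ^+ 2 <= s ^+ 2 * #|T|%:R -> \sum_p `|z p| <= s * #|T|%:R.
Proof.
move=> s_gt0 zs.
have z_le p : 2 * s * `|z p| <= z p ^+ 2 + s ^+ 2.
  have := sqr_ge0 (`|z p| - s); rewrite sqrrB real_normK ?num_real //; lra.
have s2 : 0 < 2 * s by lra.
rewrite -(ler_pM2l s2) mulr_sumr; apply: le_trans (ler_sum _ (fun p _ => z_le p)) _.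
by rewrite big_split /= sumr_const -[X in _ + X <= _]mulr_natr; lra.
Qed.

Lemma normsq_sum3 (R : realType) (a b c : R[i]) :
  `|a - b + c| ^+ 2 <= 3 * (`|a| ^+ 2 + `|b| ^+ 2 + `|c| ^+ 2).
Proof.
rewrite -!add_Re2_Im2 -!rmorphD -(rmorph_nat (real_complex R)) -rmorphM lecR.
case: a b c => [p p'] [q q'] [s s'] /=.
have := sqr_ge0 (p + q); have := sqr_ge0 (p - s); have := sqr_ge0 (q + s).
have := sqr_ge0 (p' + q'); have := sqr_ge0 (p' - s'); have := sqr_ge0 (q' + s').
lra.
Qed.

Section relative_microstates.
Context {R : realType} {M : tracialVNA R}.
Context (I1 I2 J J' : finType) (f : J' -> J).
Context (Z : I1 + I2 -> op M) (S : J -> op M).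
Hypothesis Z_sa : forall i, sa_element (Z i).
Hypothesis S_sa : forall j, sa_element (S j).

Lemma rel_microstates_restrict r l l' k e e' (A : I1 + I2 -> 'M[R[i]]_k) :
  (l' <= l)%N -> e <= e' ->
  rel_microstates Z S r l e A ->
  rel_microstates (Z \o inl) (S \o f) r l' e' (A \o inl).
Proof.
move=> ll ee [B [B_sa B_r B_m]]; exists (B \o f).
pose g (s : I1 + J') : (I1 + I2) + J :=
  match s with inl i => inl (inl i) | inr j => inr (f j) end.
have catE T (U : I1 + I2 -> T) (V : J -> T) :
    tuple_cat (U \o inl) (V \o f) = tuple_cat U V \o g.
  by apply/funext => -[].
rewrite /microstates /= !catE; split=> [j|j|w wl]; [exact: B_sa|exact: B_r|].
have := B_m (map g w); rewrite size_map => /(_ (leq_trans wl ll)).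
rewrite /prod_mx /prod_op !big_map => h; apply: lt_le_trans h _.
by rewrite lecR.
Qed.

Context (Q : I2 -> ncpoly (R := R) I1) (kappa : R).
Hypothesis kappa_gt0 : 0 < kappa.
Hypothesis Q_near : forall j,
  norm2 (Z (inr j) - ncpoly_op (Z \o inl) (Q j) : vspace_of M -> vspace_of M) <= kappa.

Let W := tuple_cat Z S.
Let defect j : ncpoly (R := R) ((I1 + I2) + J) :=
  (1, [:: inl (inr j)]) :: ncpoly_scale (-1) (ncpoly_map (inl \o inl) (Q j)).
Let square j := ncpoly_mul (ncpoly_star (defect j)) (defect j).

Let W_sa s : sa_element (W s).
Proof. by case: s. Qed.

Let defect_opE j : ncpoly_op W (defect j) = Z (inr j) - ncpoly_op (Z \o inl) (Q j).
Proof.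
rewrite ncpoly_op_cons ncpoly_op_scale ncpoly_op_map /= scale1r scaleN1r.
by rewrite /prod_op big_cons big_nil.
Qed.

Let defect_mxE k (A : (I1 + I2) + J -> 'M[R[i]]_k) j :
  ncpoly_mx A (defect j) = A (inl (inr j)) - ncpoly_mx (A \o (inl \o inl)) (Q j).
Proof.
rewrite /ncpoly_mx big_cons /= scale1r /prod_mx big_cons big_nil mulmx1; congr (_ + _).
rewrite big_map -sumrN big_map; apply: eq_bigr => t _ /=.
by rewrite mulN1r scaleNr big_map.
Qed.

(** With the moments of words correct up to [e0] in degree [l0], the moments of
    all the squares of defects are correct up to [kappa ^+ 2]. *)
Let mass := \sum_j complex.Re (ncpoly_mass (square j)).

Let mass_real j : ncpoly_mass (square j) = (complex.Re (ncpoly_mass (square j)))%:C.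
Proof. by apply/esym/RRe_real/ger0_real; apply: sumr_ge0. Qed.

Let mass_ge j : 0 <= complex.Re (ncpoly_mass (square j)) <= mass.
Proof.
have mass0 i : 0 <= complex.Re (ncpoly_mass (square i)).
  by rewrite -ler0c -mass_real; apply: sumr_ge0.
by rewrite mass0 /mass (bigD1 j) //= lerDl sumr_ge0.
Qed.

Let l0 := \max_j ncpoly_degree (square j).
Let e0 := kappa ^+ 2 / (mass + 1).

Let mass_gt0 : 0 < mass + 1.
Proof.
suff : 0 <= mass by lra.
by apply: sumr_ge0 => j _; case/andP: (mass_ge j).
Qed.

Let e0_gt0 : 0 < e0.
Proof. by rewrite divr_gt0 // exprn_gt0. Qed.

(** The square of the normalised Hilbert-Schmidt norm of the defect is a moment,
    hence close to the square of the 2-norm of the defect of the operators. *)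
Let defect_le r l k e (A : (I1 + I2) + J -> 'M[R[i]]_k) j :
  (0 < k)%N -> (l0 <= l)%N -> 0 < e -> e <= e0 -> microstates W r l e A ->
  \sum_a \sum_b `|ncpoly_mx A (defect j) a b| ^+ 2 <= (2 * k%:R * kappa ^+ 2)%:C.
Proof.
move=> k_gt0 ll e_gt0 ee mA.
have A_sa s : adjoint_mx (A s) = A s by case: mA => A_sa _ _; exact: A_sa.
have deg : (ncpoly_degree (square j) <= l)%N.
  by apply: leq_trans ll; rewrite /l0 (bigD1 j) //= leq_maxl.
have := ncpoly_moment W_sa mA deg.
rewrite ncpoly_mx_mul -adjoint_mx_ncpoly // mxtrace_adjoint_mul.
rewrite ncpoly_op_mul //.
have adjD := adjE (adjoint_ncpoly W_sa (defect j)).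
rewrite -adjD.
set D := ncpoly_op W (defect j) in adjD *.
have AD : vna M D by exact: vna_ncpoly.
set t := trace M _; set hs := \sum_a _ => near.
have t_ge0 : 0 <= t by exact: (tr_pos (traceP M) AD).
have tE : t = (norm2 D ^+ 2)%:C.
  rewrite norm2E sqr_sqrtr; last exact: (si_ge0 tau_semi_inner).
  by apply/esym/RRe_real; rewrite ger0_real.
have t_le : t <= (kappa ^+ 2)%:C.
  by rewrite tE lecR ler_sqr ?nnegrE ?norm2_ge0 ?(ltW kappa_gt0) // /D defect_opE.
have mass_e : ncpoly_mass (square j) * e%:C <= (kappa ^+ 2)%:C.
  rewrite mass_real -rmorphM lecR.
  have /andP[m0 m1] := mass_ge j.
  apply: le_trans (ler_pM m0 (ltW e_gt0) m1 ee) _.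
  rewrite /e0 mulrCA ger_pMr ?exprn_gt0 // ler_pdivrMr ?mul1r //; lra.
have k_neq0 : k%:R != 0 :> R[i] by rewrite pnatr_eq0 -lt0n.
have hs_ge0 : 0 <= hs by apply: sumr_ge0 => a _; apply: sumr_ge0 => b _; rewrite exprn_ge0.
have khs_ge0 : 0 <= k%:R^-1 * hs by rewrite mulr_ge0.
have : k%:R^-1 * hs <= (2 * kappa ^+ 2)%:C.
  rewrite -(ger0_norm khs_ge0) -(subrK t (k%:R^-1 * hs)).
  apply: le_trans (ler_normD _ _) _; rewrite (ger0_norm t_ge0).
  apply: le_trans (lerD (le_trans near mass_e) t_le) _.
  by rewrite -rmorphD lecR; lra.
rewrite ler_pdivrMl ?ltr0n // => /le_trans; apply.
rewrite -(rmorph_nat (real_complex R)) -rmorphM lecR; lra.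
Qed.

(** If two microstates have nearby first parts [A] and [A'], their second parts
    differ by their defects and by [ncpoly_mx A (Q j) - ncpoly_mx A' (Q j)]. All
    three have Hilbert-Schmidt norms of order [kappa * sqrt k]; in [k * k] real
    coordinates this is an [l1]-distance of order [kappa * k * sqrt k], that is
    [kappa / sqrt k] on average, which is the side of the cubes in
    [herm_vol_fibre]. *)
Lemma vol_rel_microstates : exists2 p : nat * R, 0 < p.2 &
  forall r l l' k e e', 0 < r -> (0 < k)%N -> (p.1 <= l)%N -> (l' <= l)%N ->
    0 < e -> e <= p.2 -> e <= e' ->
  (herm_vol (rel_microstates Z S r l (k := k) e) <=
   herm_vol (rel_microstates (Z \o inl) (S \o f) r l' (k := k) e') *
     ((8 * (4 * kappa / Num.sqrt k%:R)) ^+ (#|I2| * (k * k)))%:E)%E.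
Proof.
exists (l0, e0) => //= r l l' k e e' r_gt0 k_gt0 ll0 ll' e_gt0 ee0 ee'.
have kR_gt0 : 0 < k%:R :> R by rewrite ltr0n.
have sk_gt0 : 0 < Num.sqrt k%:R :> R by rewrite sqrtr_gt0.
set s := 4 * kappa / Num.sqrt k%:R.
have s_gt0 : 0 < s by rewrite divr_gt0 // mulr_gt0.
have rC_ge0 : 0 <= r%:C by rewrite ler0c ltW.
have /choice[L LP] : forall j, exists L : R, 0 <= L /\
    forall (A B : I1 -> 'M[R[i]]_k) (eta : R), 0 <= eta ->
    (forall i a b, `|A i a b| <= r%:C) -> (forall i a b, `|B i a b| <= r%:C) ->
    (forall i a b, `|A i a b - B i a b| <= eta%:C) ->
    forall a b, `|ncpoly_mx A (Q j) a b - ncpoly_mx B (Q j) a b| <= (L * eta)%:C.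
  move=> j; have [L L_ge0 LP] := ncpoly_lipschitz k (Q j) rC_ge0.
  have LE : L = (complex.Re L)%:C by apply/esym/RRe_real; rewrite ger0_real.
  exists (complex.Re L); split; first by rewrite -ler0c -LE.
  move=> A B eta eta_ge0 Ar Br AB a b; rewrite rmorphM /= -LE.
  by apply: LP => //; rewrite ler0c.
pose Lmax := \sum_j L j.
have Lmax_ge0 : 0 <= Lmax by apply: sumr_ge0 => j _; case: (LP j).
have L_le j : L j <= Lmax.
  by rewrite /Lmax (bigD1 j) //= lerDl; apply: sumr_ge0 => i _; case: (LP i).
(* Chosen so that the entries of the values of the polynomials at points
   [eta]-close to each other differ by at most [kappa / k]. *)
pose eta := kappa / (2 * (Lmax + 1) * k%:R).
have eta_gt0 : 0 < eta by rewrite divr_gt0 // !mulr_gt0 //; lra.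
apply: (herm_vol_fibre s_gt0 eta_gt0).
  by move=> A; exact: rel_microstates_restrict.
move=> x y [B mB] [C mC] xy j.
set A := tuple_cat _ B in mB; set A' := tuple_cat _ C in mC.
have Ar s' a b : `|A s' a b| <= r%:C.
  by apply: opnorm_le_entry; [exact: ltW|case: mB => _ B_r _; exact: B_r].
have A'r s' a b : `|A' s' a b| <= r%:C.
  by apply: opnorm_le_entry; [exact: ltW|case: mC => _ C_r _; exact: C_r].
pose E := ncpoly_mx (A \o (inl \o inl)) (Q j) - ncpoly_mx (A' \o (inl \o inl)) (Q j).
have E_le a b : `|E a b| ^+ 2 <= ((kappa / k%:R) ^+ 2)%:C.
  have [L_ge0 /(_ (A \o (inl \o inl)) (A' \o (inl \o inl)) (2 * eta))] := LP j.
  have eta2 : 0 <= 2 * eta by lra.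
  have AA' i c d : `|(A \o (inl \o inl)) i c d - (A' \o (inl \o inl)) i c d| <= (2 * eta)%:C.
    have := @herm_mx_near _ _ _ eta (xy i) c d.
    by rewrite -herm_mxB !mxE.
  move=> /(_ eta2 (fun i => Ar _) (fun i => A'r _) AA' a b) h.
  have -> : E a b = ncpoly_mx (A \o (inl \o inl)) (Q j) a b -
     ncpoly_mx (A' \o (inl \o inl)) (Q j) a b by rewrite !mxE.
  rewrite rmorphXn; apply: lerXn2r; first by rewrite nnegrE.
    by rewrite nnegrE ler0c divr_ge0 // ltW.
  apply: le_trans h _; rewrite lecR.
  apply: le_trans (ler_wpM2r eta2 (L_le j)) _.
  have -> : Lmax * (2 * eta) = kappa / k%:R * (Lmax / (Lmax + 1)).
    by rewrite /eta; field; apply/andP; split; apply: lt0r_neq0 => //; lra.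
  by rewrite ger_pMr ?divr_gt0 // ler_pdivrMr ?mul1r; lra.
have diffE a b : herm_mx (fun p => x (inr j) p - y (inr j) p) a b =
    ncpoly_mx A (defect j) a b - ncpoly_mx A' (defect j) a b + E a b.
  by rewrite -herm_mxB !defect_mxE /E !mxE /=; ring.
have hsA := defect_le j k_gt0 ll0 e_gt0 ee0 mB.
have hsA' := defect_le j k_gt0 ll0 e_gt0 ee0 mC.
have hsE : \sum_a \sum_b `|E a b| ^+ 2 <= (kappa ^+ 2)%:C.
  apply: le_trans (ler_sum _ (fun a _ => ler_sum _ (fun b _ => E_le a b))) _.
  rewrite !sumr_const card_ord -!rmorphMn lecR -mulrnA -[leLHS]mulr_natr natrM.
  have -> // : (kappa / k%:R) ^+ 2 * (k%:R * k%:R) = kappa ^+ 2.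
  by field; exact: lt0r_neq0.
(* The three squared norms add up to 3 * (2 + 2 + 1) <= 16. *)
have : (\sum_p (x (inr j) p - y (inr j) p) ^+ 2)%:C <= (16 * k%:R * kappa ^+ 2)%:C.
  rewrite -sum_normsq_herm_mx.
  apply: le_trans (_ : \sum_a \sum_b 3 * (`|ncpoly_mx A (defect j) a b| ^+ 2 +
      `|ncpoly_mx A' (defect j) a b| ^+ 2 + `|E a b| ^+ 2) <= _).
    by apply: ler_sum => a _; apply: ler_sum => b _; rewrite diffE; exact: normsq_sum3.
  have -> : \sum_a \sum_b 3 * (`|ncpoly_mx A (defect j) a b| ^+ 2 +
      `|ncpoly_mx A' (defect j) a b| ^+ 2 + `|E a b| ^+ 2) =
      3 * (\sum_a \sum_b `|ncpoly_mx A (defect j) a b| ^+ 2 +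
        \sum_a \sum_b `|ncpoly_mx A' (defect j) a b| ^+ 2 + \sum_a \sum_b `|E a b| ^+ 2).
    rewrite -!big_split /= mulr_sumr; apply: eq_bigr => a _.
    by rewrite -!big_split /= mulr_sumr.
  apply: le_trans (ler_wpM2l (ler0n _ 3) (lerD (lerD hsA hsA') hsE)) _.
  rewrite -!rmorphD -(rmorph_nat (real_complex R)) -rmorphM lecR.
  have k_ge1 : 1 <= k%:R :> R by rewrite ler1n.
  by have := ler_wpM2r (sqr_ge0 kappa) k_ge1; have := sqr_ge0 kappa; lra.
rewrite lecR => h.
have -> : (k * k)%N = #|{: 'I_k * 'I_k}| by rewrite card_prod card_ord.
apply: sum_normr_le => //; apply: le_trans h _.
rewrite card_prod card_ord natrM /s exprMn exprVn sqr_sqrtr ?ler0n // exprMn.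
by rewrite le_eqVlt; apply/orP; left; apply/eqP; field; exact: lt0r_neq0.
Qed.

End relative_microstates.

(** * Entropy and boundedness *)

Lemma limf_esup_le_add (T : choiceType) (X : filteredType T) (R : realType)
    (F : set_system X) (f g : X -> \bar R) (c : R) : Filter F ->
  (\forall x \near F, (f x <= g x + c%:E)%E) ->
  (limf_esup f F <= limf_esup g F + c%:E)%E.
Proof.
move=> FF fg; rewrite -leeBlDr //; apply: le_ereal_inf_tmp => _ [V FV <-].
rewrite leeBlDr //.
apply: (@le_trans _ _ (ereal_sup (f @` (V `&` [set x | (f x <= g x + c%:E)%E])))).
  apply: ereal_inf_lbound; exists (V `&` [set x | (f x <= g x + c%:E)%E]) => //.
  exact: filterI.
apply: ge_ereal_sup => _ [x [Vx fgx] <-]; apply: le_trans fgx _; apply: leeD2r.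
by apply: ereal_sup_ubound; exists x.
Qed.

Lemma lne_mul_le (R : realType) (V W : \bar R) (c : R) :
  (0 <= V)%E -> (0 <= W)%E -> 0 < c -> (V <= W * c%:E)%E ->
  (lne V <= lne W + (ln c)%:E)%E.
Proof.
move=> V_ge0 W_ge0 c_gt0 VW.
have [W0|W_gt0] := eqVneq W 0%E.
  rewrite le0_lneNy ?leNye //.
  by apply: le_trans VW _; rewrite W0 mul0e.
have {}W_gt0 : (0 < W)%E by rewrite lt_neqAle eq_sym W_gt0.
rewrite -lne_EFin // -lneM ?in_itv /= ?leey ?andbT ?lte_fin //.
by rewrite lee_lne // in_itv /= leey andbT // mule_ge0 // lee_fin ltW.
Qed.

(** The logarithm of the fibre volume, divided by [k * k], is
    [m * ln (32 * kappa) - m / 2 * ln k], and its last term is exactly compensated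
    by the normalisation of the entropy of the larger tuple. *)
Lemma entropy_step (R : realType) (V W : \bar R) (k m : nat) (kappa i1 : R) :
  (0 < k)%N -> 0 < kappa -> (0 <= V)%E -> (0 <= W)%E ->
  (V <= W * ((8 * (4 * kappa / Num.sqrt k%:R)) ^+ (m * (k * k)))%:E)%E ->
  ((k%:R ^- 2)%:E * lne V + (((i1 + m%:R) / 2 * ln k%:R)%R)%:E <=
   (k%:R ^- 2)%:E * lne W + ((i1 / 2 * ln k%:R)%R)%:E
     + (m%:R * ln (32 * kappa))%:E)%E.
Proof.
move=> k_gt0 kappa_gt0 V_ge0 W_ge0 VW.
have kR : 0 < k%:R :> R by rewrite ltr0n.
have sk : 0 < Num.sqrt k%:R :> R by rewrite sqrtr_gt0.
have k2 : 0 < k%:R ^- 2 :> R by rewrite invr_gt0 exprn_gt0.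
set b := 8 * _ in VW.
have b_gt0 : 0 < b by rewrite mulr_gt0 // divr_gt0 // mulr_gt0.
have ln_sk : ln (Num.sqrt k%:R) = ln k%:R / 2 :> R.
  have := lnXn 2 sk; rewrite sqr_sqrtr ?ler0n //.
  by move=> ->; rewrite -[X in _ = X / _]mulr_natr mulfK.
have ln_b : ln b = ln (32 * kappa) - ln k%:R / 2.
  have -> : b = 32 * kappa / Num.sqrt k%:R by rewrite /b; field; exact: lt0r_neq0.
  by rewrite ln_div ?posrE ?mulr_gt0 // ln_sk.
have := lne_mul_le V_ge0 W_ge0 (exprn_gt0 _ b_gt0) VW.
rewrite lnXn // => h.
have {}h : ((k%:R ^- 2)%:E * lne V <= (k%:R ^- 2)%:E * lne W + (m%:R * ln b)%:E)%E.
  apply: le_trans (lee_wpmul2l _ h) _; first by rewrite lee_fin ltW.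
  rewrite muleDr //; last by rewrite fin_num_adde_defl.
  rewrite -EFinM.
  rewrite (_ : _ * _ = m%:R * ln b) //.
  by rewrite -[ln b *+ _]mulr_natr !natrM; field; exact: lt0r_neq0.
apply: le_trans (leeD2r _ h) _.
rewrite -!addeA; apply: leeD2l; rewrite -!EFinD lee_fin ln_b.
by rewrite le_eqVlt; apply/orP; left; apply/eqP; field.
Qed.

(** The thresholds on the degree and the precision of the moments under which
    [vol_rel_microstates] holds disappear in the infimum that defines [chi]. *)
Lemma chi_fibre (R : realType) (M : tracialVNA R) (I1 I2 J J' : finType)
    (f : J' -> J) (Z : I1 + I2 -> op M) (S : J -> op M) (Q : I2 -> ncpoly I1)
    (kappa : R) :
  (forall i, sa_element (Z i)) -> (forall j, sa_element (S j)) -> 0 < kappa ->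
  (forall j, norm2 (Z (inr j) - ncpoly_op (Z \o inl) (Q j) :
                      vspace_of M -> vspace_of M) <= kappa) ->
  (chi Z S <= chi (Z \o inl) (S \o f) + (#|I2|%:R * ln (32 * kappa))%:E)%E.
Proof.
move=> Z_sa S_sa kappa_gt0 Q_near.
have [[l0 e0] /= e0_gt0 vol_le] := vol_rel_microstates f Z_sa S_sa kappa_gt0 Q_near.
apply: ge_ereal_sup => _ [r /= r_gt0 <-].
apply: le_trans (leeD2r _ (ereal_sup_ubound _)); last by exists r.
rewrite -leeBlDr //; apply: le_ereal_inf_tmp => _ [[l e] /= e_gt0 <-].
rewrite EFinN leeBlDr //.
apply: le_trans (ereal_inf_lbound _) _.
  by exists (maxn l0 l, Num.min e0 e) => //=; rewrite lt_min e0_gt0.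
apply: limf_esup_le_add; exists 1%N => // k /= k_gt0.
rewrite card_sum natrD.
apply: entropy_step => //; try exact: lebesgue_vol_ge0.
apply: vol_le => //; rewrite ?leq_maxl ?leq_maxr ?ge_min ?lexx ?orbT //.
by rewrite lt_min e0_gt0.
Qed.

Section freeness.
Context {R : realType} {M : tracialVNA R}.

Lemma freely_independent_sub (J J' : Type) (g : J' -> J) (F : J -> set (op M))
    (F' : J' -> set (op M)) : injective g -> (forall j, F' j `<=` F (g j)) ->
  freely_independent F -> freely_independent F'.
Proof.
move=> g_inj F'F F_free n i a aF' i_alt; apply: (F_free n (g \o i)).
  by move=> j /aF'[aj a0]; split=> //; exact: star_alg_le aj.
by move=> j /i_alt ij /g_inj /ij.
Qed.

Lemma semicircular_family_sub (J J' : Type) (g : J' -> J) (S : J -> op M)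
    (A A' : set (op M)) : injective g -> A' `<=` A ->
  free_semicircular_family_free_from S A ->
  free_semicircular_family_free_from (S \o g) A'.
Proof.
move=> g_inj A'A [S_sc S_free]; split; first by move=> j; exact: S_sc.
apply: (@freely_independent_sub _ _ (omap g)) S_free.
  by move=> [j|] [j'|] //= [/g_inj ->].
by case=> [j|] //=.
Qed.

(** Polynomials are 2-norm dense in [W_star A], and freeness passes to 2-norm
    closures. A family free from the generators can thus serve both for
    boundedness and for the distance function. *)
Lemma semicircular_family_W_star (J : Type) (S : J -> op M) (A : set (op M)) :
  A `<=` vna M -> free_semicircular_family_free_from S A ->
  free_semicircular_family_free_from S (W_star A).
Proof.
move=> AM [S_sc S_free]; split=> //.
have SM j : [set S j] `<=` vna M by move=> _ ->; exact: (S_sc j).1.1.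
apply: free_closure S_free.
  by case.
move=> [j|] T e ST e_gt0.
  split; first by apply: (star_alg_min vna_star (SM j)).
  exists T => //.
  by rewrite subrr norm2E (si0l tau_semi_inner) ?sqrtr0 ?ltW //; exact: vna0.
apply: W_star_dense => //.
by apply: (star_alg_min (B := W_star A)) ST => //; exact: W_star_star (vnaP M) AM.
Qed.

Lemma d2_approx (J : finType) (Y : op M) (X S : J -> op M) (e c : R) :
  sa_element Y -> (forall j, sa_element (perturb X S e j)) -> 0 < e ->
  d2 Y X S e <= c -> exists Q, norm2 (Y - ncpoly_op (perturb X S e) Q :
    vspace_of M -> vspace_of M) <= c + 2 * e.
Proof.
move=> Y_sa X_sa e_gt0 d2c.
have XM : range (perturb X S e) `<=` vna M by move=> _ [j _ <-]; exact: (X_sa j).1.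
have W_star_e := W_star_star (vnaP M) XM.
have d2_inf : has_inf [set norm2 (Y \- T) | T in W_star (range (perturb X S e))].
  split; first by exists (norm2 (Y \- id)), id => //; exact: star_one.
  by exists 0 => _ [T _ <-]; exact: norm2_ge0.
have [_ [T WT <-] YT] := inf_adherent e_gt0 d2_inf.
have [AT [P SP PT]] := W_star_dense XM WT e_gt0.
have [Q PQ] := star_alg_ncpoly X_sa SP.
have AP : vna M P by rewrite PQ; exact: vna_ncpoly.
exists Q; rewrite -PQ.
have -> : (Y - P : vspace_of M -> vspace_of M) = (Y - T) + - (P - T).
  by rewrite opprB addrA subrK.
have AYT : vna M (Y - T : vspace_of M -> vspace_of M) by apply: vnaB => //; exact: Y_sa.1.
have APT := vnaB AP AT.
have APT' : vna M (- (P - T)) by rewrite opprB; exact: vnaB.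
apply: le_trans (norm2D AYT APT') _; rewrite norm2N //.
have : norm2 (Y - T : vspace_of M -> vspace_of M) < d2 Y X S e + e := YT.
lra.
Qed.

Lemma sa_perturb (J : Type) (X S : J -> op M) (e : R) :
  (forall j, sa_element (X j)) -> (forall j, sa_element (S j)) ->
  forall j, sa_element (perturb X S e j).
Proof.
move=> X_sa S_sa j; have [AX XX] := X_sa j; have [AS SS] := S_sa j.
have -> : perturb X S e j = (e%:C \*: S j \+ X j).
  by apply/funext => v; rewrite /perturb /= addrC.
split; first exact: vna_lin.
have := adjoint_lin e%:C SS XX; by rewrite conjc_real.
Qed.

End freeness.

Lemma sa_enlargement (R : realType) (M N : tracialVNA R) (phi : op M -> op N) T :
  enlargement phi -> sa_element T -> sa_element (phi T).
Proof.
move=> enl [AT TT]; split; first exact: enl_in enl _ AT.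
by have := enl_adj enl AT; rewrite (adjE TT).
Qed.

Theorem lemma4p1 (R : realType) (M : tracialVNA R) (alpha : R) (n m : nat)
    (X : 'I_n -> op M) (Y : 'I_m -> op M)
    (alpha_gt0 : 0 < alpha)
    (X_sa : forall i, sa_element (X i))
    (Y_sa : forall j, sa_element (Y j))
    (Y_in : forall j, W_star (range X) (Y j))
    (Y_d2 : forall j, d2_linear (Y j) X)
    (X_bounded : alpha_bounded alpha X) :
  alpha_bounded alpha (tuple_cat X Y).
Proof.
move=> N phi S enl S_free.
have Z_sa s : sa_element (phi (tuple_cat X Y s)).
  by apply: (sa_enlargement enl); case: s.
have S_sa s : sa_element (S s) := (S_free.1 s).1.
pose X' := phi \o X; pose S1 := S \o inl.
have X'_sa i : sa_element (X' i) := Z_sa (inl i).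
have S1_free : free_semicircular_family_free_from S1 (range X').
  apply: semicircular_family_sub S_free; first by move=> i j [].
  by move=> _ [i _ <-]; exists (inl i).
have S1_free_W : free_semicircular_family_free_from S1 (W_star (range X')).
  by apply: semicircular_family_W_star => // _ [i _ <-]; exact: (X'_sa i).1.
have := X_bounded N phi S1 enl S1_free.
set g := (X in (limf_esup X _ < _)%E) => g_bounded.
have /choice[C CP] : forall j, exists C : R, \forall e \near 0^'+,
    `|e^-1 * d2 (phi (Y j)) X' S1 e| <= C.
  by move=> j; have /ex_bound[C] := Y_d2 j N phi S1 enl S1_free_W; exists C.
(* [C j] comes from the distance, 2 from the choice of a nearly optimal element
   and of a polynomial near it, the last sum from the perturbation of [Y]; the
   first term only ensures positivity. *)
pose K := 1 + \sum_j `|C j| + 2 + \sum_j norm2 (S (inr j)).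
have C_le j : C j <= \sum_j `|C j|.
  by apply: le_trans (ler_norm _) _; rewrite (bigD1 j) //= lerDl sumr_ge0.
have S_le j : norm2 (S (inr j)) <= \sum_j norm2 (S (inr j)).
  by rewrite [leRHS](bigD1 j) //= lerDl sumr_ge0 // => i _; exact: norm2_ge0.
have K_gt0 : 0 < K.
  have h1 : 0 <= \sum_j `|C j| by apply: sumr_ge0.
  have h2 : 0 <= \sum_j norm2 (S (inr j)) by apply: sumr_ge0 => i _; exact: norm2_ge0.
  by rewrite /K; lra.
suff key : \forall e \near 0^'+,
   (chi (perturb (phi \o tuple_cat X Y) S e) S +
      ((#|{: 'I_n + 'I_m}|%:R - alpha) * `|ln e|)%:E <=
    g e + (m%:R * ln (32 * K))%:E)%E.
  apply: le_lt_trans (limf_esup_le_add _ key) _.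
  by rewrite lte_add_pinfty ?ltry.
have allC := filter_forall _ CP.
near=> e.
have e_gt0 : 0 < e by near: e; exact: nbhs_right_gt.
have e_lt1 : e < 1 by near: e; exact: nbhs_right_lt.
have Ce j : `|e^-1 * d2 (phi (Y j)) X' S1 e| <= C j.
  by move: j; near: e; exact: allC.
set Z := perturb _ S e.
have Z_saE : forall s, sa_element (Z s) by apply: sa_perturb.
have Ke_gt0 : 0 < K * e by rewrite mulr_gt0.
have /choice[Q QP] : forall j, exists Q, norm2 (Z (inr j) - ncpoly_op (Z \o inl) Q :
    vspace_of N -> vspace_of N) <= K * e.
  move=> j.
  have d2_le : d2 (phi (Y j)) X' S1 e <= C j * e.
    rewrite -ler_pdivrMr // mulrC; exact: le_trans (ler_norm _) (Ce j).
  have [Q QP] := d2_approx (Z_sa (inr j)) (fun i => Z_saE (inl i)) e_gt0 d2_le.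
  exists Q.
  have ES : (Z (inr j) - ncpoly_op (Z \o inl) Q : vspace_of N -> vspace_of N) =
      (phi (Y j) - ncpoly_op (Z \o inl) Q) + e%:C *: (S (inr j) : _ -> _).
    by rewrite addrAC.
  rewrite ES.
  have AQ : vna N (ncpoly_op (Z \o inl) Q) by apply: vna_ncpoly => i; exact: Z_saE.
  have AY : vna N (phi (Y j)) := (Z_sa (inr j)).1.
  have AS : vna N (S (inr j)) := (S_sa (inr j)).1.
  apply: le_trans (norm2D (vnaB AY AQ) (vnaZ _ AS)) _.
  rewrite norm2Z // (gtr0_norm e_gt0).
  apply: le_trans (lerD QP (lexx _)) _.
  have := ler_wpM2r (ltW e_gt0) (C_le j); have := ler_wpM2r (ltW e_gt0) (S_le j).
  rewrite /K; lra.
have := chi_fibre inl Z_saE S_sa Ke_gt0 QP.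
move=> /(leeD2r (((#|{: 'I_n + 'I_m}|%:R - alpha) * `|ln e|)%:E)) /le_trans; apply.
rewrite /g -!addeA; apply: leeD2l; rewrite -!EFinD lee_fin.
rewrite card_sum !card_ord natrD.
have ln_e : `|ln e| = - ln e.
  by rewrite ler0_norm // ln_le0 // ltW.
(* As [e < 1], [ln (32 * K * e) = ln (32 * K) - `|ln e|]. *)
rewrite mulrA lnM ?posrE ?mulr_gt0 // ln_e.
by rewrite le_eqVlt; apply/orP; left; apply/eqP; ring.
Unshelve. all: by end_near. Qed.
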